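(* Let $A\in\mathbb{C}$, $-1\le B\le 0$, $A\ne B$. Then the logarithmic coefficients $d_{n(j+k-1)}$ of $f_{j,k}\in\mathcal{ST}_{[j,k]}(A,B)$ satisfy $$\sum_{n=1}^{\infty}n^2|d_{n(j+k-1)}|^{2}\le \frac{1}{4(j+k-1)^2}\,\frac{|A-B|^2}{1-B^2}\qquad\text{for } B\neq-1.$$ The inequality is sharp for the function $K^{(j,k)}_{A,B}$.
   Context: $\mathbb{D}=\{z\in\mathbb{C}:|z|<1\}$; $\mathcal{A}$ is the class of analytic functions $f$ in $\mathbb{D}$ with $f(0)=0$, $f'(0)=1$. For analytic $p,q$ in $\mathbb{D}$, $p\prec q$ (subordination) means $p=q\circ\omega$ for some analytic $\omega:\mathbb{D}\to\mathbb{D}$ with $\omega(0)=0$. Here $k\in\mathbb{N}$ and $j\in\{0,1,\dots,k-1\}$, the case $(j,k)=(1,1)$ also being allowed, with $j+k-1\ge1$. A function $f:\mathbb{D}\to\mathbb{C}$ is called $(j,k)$-symmetric if $f(\epsilon z)=\epsilon^{j}f(z)$ for all $z\in\mathbb{D}$, where $\epsilon=e^{2\pi i/k}$. The class $\mathcal{ST}_{[j,k]}(A,B)$ is the class of $(j,k)$-symmetric functions in $\mathcal{A}$ of the form $$f_{j,k}(z)=z+\sum_{n=1}^\infty a_{nk+j}z^{nk+j},\qquad z\in\mathbb{D},$$ which satisfy $$\frac{z f_{j,k}'(z)}{f_{j,k}(z)}\prec\frac{1+Az^{j+k-1}}{1+Bz^{j+k-1}},\qquad z\in\mathbb{D}.$$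 The logarithmic coefficients $d_{n(j+k-1)}$ of $f_{j,k}$ are defined by $$\log\left(\frac{f_{j,k}(z)}{z}\right)=2\sum_{n=1}^\infty d_{n(j+k-1)}z^{n(j+k-1)},\qquad z\in\mathbb{D}.$$ The function $K^{(j,k)}_{A,B}$ is $$K^{(j,k)}_{A,B}(z)=\begin{cases} z\,e^{\frac{A z^{j+k-1}}{j+k-1}}, & B=0,\\ z\,(1+Bz^{j+k-1})^{\frac{A-B}{(j+k-1)B}}, & B\ne0.\end{cases}$$
   Formalization: Equality for K is proved for all admissible (j,k), but membership of K in the class ST_[j,k](A,B) is claimed only for j = 1: (j,k)-symmetry with f'(0) = 1 forces j = 1, so for other j the class is empty and the sharpness claim fails. *)

(* Defs.v *)
(* Stdlib reals with Coquelicot's complex numbers. *)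
From Stdlib Require Import Reals Lra Lia.
From Coquelicot Require Import Coquelicot.
Open Scope C_scope.

Definition in_disk (z : C) : Prop := (Cmod z < 1)%R.

(* Analytic in the disk = complex differentiable at each of its points. *)
Definition analytic_in_disk (f : C -> C) : Prop :=
  forall z : C, in_disk z ->
    ex_derive (K := C_AbsRing) (V := C_NormedModule) f z.

Definition Cexp (z : C) : C :=
  ((exp (Re z) * cos (Im z))%R, (exp (Re z) * sin (Im z))%R).

(* Principal argument, with values in (-PI, PI] for z <> 0. *)
Definition Carg (z : C) : R :=
  if Rle_dec 0 (Im z) then acos (Re z / Cmod z) else (- acos (Re z / Cmod z))%R.

Definition CLog (z : C) : C := (ln (Cmod z), Carg z).

(* Principal power w ^ a, for w <> 0. *)
Definition Cpower (w a : C) : C := Cexp (a * CLog w).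

Definition class_A (f : C -> C) : Prop :=
  analytic_in_disk f /\ f 0 = 0 /\
  is_derive (K := C_AbsRing) (V := C_NormedModule) f (RtoC 0) (RtoC 1).

Definition subordinate (p q : C -> C) : Prop :=
  analytic_in_disk p /\ analytic_in_disk q /\
  exists w : C -> C,
    analytic_in_disk w /\ w 0 = 0 /\
    (forall z : C, in_disk z -> in_disk (w z)) /\
    (forall z : C, in_disk z -> p z = q (w z)).

Definition root_of_unity (k : nat) : C := Cexp (RtoC (2 * PI / INR k) * Ci).

Definition jk_symmetric (j k : nat) (f : C -> C) : Prop :=
  forall z : C, in_disk z ->
    f (root_of_unity k * z) = root_of_unity k ^ j * f z.

(* z f'(z) / f(z) and f(z) / z have removable singularities at 0 when f is in
   class_A, both with value 1; Coquelicot's total division would give 0. *)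
Definition log_derivative (f : C -> C) (z : C) : C :=
  if Ceq_dec z 0 then 1 else z * C_derive f z / f z.

Definition over_z (f : C -> C) (z : C) : C :=
  if Ceq_dec z 0 then 1 else f z / z.

(* Series over n >= 1 are indexed from 0, hence the S n here and below. *)
Definition ST (j k : nat) (A B : C) (f : C -> C) : Prop :=
  class_A f /\
  jk_symmetric j k f /\
  (exists a : nat -> C, forall z : C, in_disk z ->
     is_series (K := C_AbsRing) (V := C_NormedModule)
       (fun n : nat => a (S n * k + j)%nat * z ^ (S n * k + j)) (f z - z)) /\
  subordinate (log_derivative f)
    (fun z : C => (1 + A * z ^ (j + k - 1)) / (1 + B * z ^ (j + k - 1))).

(* log (f(z)/z) is the analytic branch L vanishing at 0.  Only the values of d
   at the positive multiples of j+k-1 matter. *)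
Definition log_coefficients (j k : nat) (f : C -> C) (d : nat -> C) : Prop :=
  exists L : C -> C,
    analytic_in_disk L /\ L 0 = 0 /\
    (forall z : C, in_disk z -> Cexp (L z) = over_z f z) /\
    (forall z : C, in_disk z ->
       is_series (K := C_AbsRing) (V := C_NormedModule)
         (fun n : nat => d (S n * (j + k - 1))%nat * z ^ (S n * (j + k - 1)))
         (L z / 2)).

Definition K_extremal (j k : nat) (A : C) (B : R) (z : C) : C :=
  if Req_EM_T B 0 then
    z * Cexp (A * z ^ (j + k - 1) / INR (j + k - 1))
  else
    z * Cpower (1 + B * z ^ (j + k - 1)) ((A - B) / (INR (j + k - 1) * B)).

Lemma root_of_unity_pow (k n : nat) :
  root_of_unity k ^ n =
    (cos (INR n * (2 * PI / INR k))%R, sin (INR n * (2 * PI / INR k))%R).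
Proof.
assert (E : root_of_unity k =
  (cos (2 * PI / INR k)%R, sin (2 * PI / INR k)%R)).
{ unfold root_of_unity, Cexp.
  replace (Re _) with 0%R by (simpl; ring).
  replace (Im _) with (2 * PI / INR k)%R by (simpl; ring).
  rewrite exp_0, !Rmult_1_l; reflexivity. }
rewrite E; set (t := (2 * PI / INR k)%R).
induction n as [|n IH].
- simpl; rewrite Rmult_0_l, cos_0, sin_0; reflexivity.
- rewrite Cpow_S, IH, S_INR, Rmult_plus_distr_r, Rmult_1_l, cos_plus, sin_plus.
  unfold Cmult; simpl; f_equal; ring.
Qed.

(* Comparing derivatives at 0 in the symmetry relation: the normalisation
   f'(0) = 1 leaves only j = 1. *)
Lemma ST_j_eq_1 (j k : nat) (A B : C) (f : C -> C) :
  (1 <= k)%nat -> (j < k)%nat \/ (j = 1%nat /\ k = 1%nat) ->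
  (1 <= j + k - 1)%nat -> ST j k A B f -> j = 1%nat.
Proof.
intros hk hj hjk [[_ [_ Hd]] [Hs _]].
destruct hj as [hj|[-> _]]; [|reflexivity].
set (e := root_of_unity k) in *.
assert (H1 : is_derive (K := C_AbsRing) (V := C_NormedModule)
  (fun z : C => f (e * z)) (RtoC 0) e).
{ assert (Hg : is_derive (K := C_AbsRing)
    (V := AbsRing_NormedModule C_AbsRing) (fun z : C => e * z) (RtoC 0) e).
  { pose proof (is_derive_scal_l (K := C_AbsRing)
      (V := AbsRing_NormedModule C_AbsRing) (fun z : C => z) (RtoC 0) _ e
      (is_derive_id (K := C_AbsRing) (RtoC 0))) as H.
    change (scal one e) with (RtoC 1 * e) in H; rewrite Cmult_1_l in H.
    revert H; apply (is_derive_ext (K := C_AbsRing)).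
    intros t; apply Cmult_comm. }
  assert (Hd' : is_derive (K := C_AbsRing) (V := C_NormedModule) f
    (e * RtoC 0) (RtoC 1)) by (rewrite Cmult_0_r; exact Hd).
  pose proof (is_derive_comp (K := C_AbsRing) (V := C_NormedModule) f
    (fun z : C => e * z) (RtoC 0) (RtoC 1) e Hd' Hg) as H.
  change (scal e (RtoC 1)) with (e * RtoC 1) in H.
  rewrite Cmult_1_r in H; exact H. }
assert (H2 : is_derive (K := C_AbsRing) (V := C_NormedModule)
  (fun z : C => e ^ j * f z) (RtoC 0) (e ^ j)).
{ eapply filterdiff_ext_lin.
  - apply (filterdiff_scal_r_fct (K := C_AbsRing)
             (U := AbsRing_NormedModule C_AbsRing) (V := C_NormedModule)
             (e ^ j) f); [exact Cmult_comm | exact Hd].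
  - intros y; simpl. change (e ^ j * (y * 1) = y * e ^ j); ring. }
assert (H3 : e = e ^ j).
{ rewrite <- (is_C_derive_unique _ _ _ H1) at 1; apply is_C_derive_unique.
  apply (is_derive_ext_loc (K := C_AbsRing) (fun z : C => e ^ j * f z));
    [|exact H2].
  exists (mkposreal 1 Rlt_0_1); intros z Hz; symmetry; apply Hs.
  change (Cmod (z - 0) < 1)%R in Hz.
  replace z with (z - 0) by ring; exact Hz. }
rewrite <- (Cpow_1_r e) in H3 at 1; unfold e in H3.
rewrite !root_of_unity_pow in H3.
injection H3 as Hc Hsn; rewrite Rmult_1_l in Hc, Hsn.
set (t := (2 * PI / INR k)%R) in *.
assert (Hk : (0 < INR k)%R) by (apply lt_0_INR; lia).
assert (Ht : (t * INR k = 2 * PI)%R) by (unfold t; field; lra).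
pose proof PI_RGT_0 as HPI.
assert (Hcos : cos ((INR j - 1) * t)%R = 1%R).
{ replace ((INR j - 1) * t)%R with (INR j * t - t)%R by ring.
  rewrite cos_minus, <- Hc, <- Hsn.
  pose proof (sin2_cos2 t) as H; unfold Rsqr in H; lra. }
assert (Hlt : forall x : R, (0 < x < 2 * PI)%R -> cos x <> 1%R).
{ intros x Hx E. replace x with (2 * (x / 2))%R in E by field.
  rewrite cos_2a_sin in E.
  assert (0 < sin (x / 2))%R by (apply sin_gt_0; lra). nra. }
assert (Ht0 : (0 < t)%R) by (unfold t; apply Rdiv_lt_0_compat; lra).
destruct j as [|[|j]]; [exfalso | reflexivity | exfalso].
- replace ((INR 0 - 1) * t)%R with (- t)%R in Hcos by (simpl; ring).
  rewrite cos_neg in Hcos; apply (Hlt t); [|exact Hcos]; split; [lra|].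
  assert (2 <= INR k)%R by (apply (le_INR 2); lia). nra.
- apply (Hlt _) in Hcos; [exact Hcos|].
  apply lt_INR in hj. rewrite !S_INR in *.
  pose proof (pos_INR j). split; nra.
Qed.

(* Main.v *)
(* Put m = j + k - 1.  With log (f(z)/z) = L(z), the subordination says that
   G = z L'(z) satisfies G = phi (A - B - B G) for some |phi| < 1, so that
   |G| <= |A - B - B G|.  Since G(0) = 0, taking quadratic means on circles gives
   M(G) <= |A - B|^2 + B^2 M(G), and the coefficient of z^(nm) in G is
   2 n m d_(nm).  The means are taken over roots of unity, applied to partial sums
   of the power series.

   For the extremal function put beta = (A - B)/m and
   Lambda(u) = sum_(n >= 0) beta (-B)^n u^(n+1) / (n+1), so that
   Lambda' = beta / (1 + B u); then K(z) = z exp (Lambda (z^m)), and K(z)/z is a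
   power series in z^m because the solution by series of (1 + B u) Y' = beta Y,
   Y(0) = 1, is exp o Lambda. *)
Require Import Defs.
From Stdlib Require Import Reals Lra Lia.
From Coquelicot Require Import Coquelicot.
Open Scope C_scope.

(** * Complex derivatives and the exponential *)

(** The estimate is carried out in the variable u = z^m: the map z -> z^m sends the disk onto
    itself, so a bound at every z is a bound at every u, and in u the exponents are consecutive.
    Sampling at N + 1 roots of unity makes Parseval's identity exact for polynomials of degree at
    most N, so no integral is involved; the price is a truncation error, absorbed by an epsilon, and
    a final passage of the radius to 1. In the mean of |A - B - B G|^2 the mixed terms vanish
    because A - B is constant and G has no constant term; this is why the right-hand side is |A -
    B|^2 + B^2 M(G). For the extremal function phi = z^m, so the loss disappears as |z| tends to 1.
    There G has coefficients (A - B)(-B)^(n-1), and the geometric series in B^2 is the origin of 1 /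
    (1 - B^2). The coefficients of Lambda and of its exponential involve no division by B, so that B
    = 0 is covered too. A branch matters only in the principal power inside [K_extremal], which must
    be matched with the exponential of a power series. *)

Definition is_Cderive (f : C -> C) (z l : C) : Prop :=
  is_derive (K := C_AbsRing) (V := C_NormedModule) f z l.

(** [C] carries two normed-module structures over itself: the derivatives here use one, the product
    rule and inner functions of the chain rule use the other. The data agree by conversion; only the
    linearity record has to be rebuilt. *)
Lemma is_Cderive_AbsRing (f : C -> C) (z l : C) :
  is_Cderive f z l <->
  is_derive (K := C_AbsRing) (V := AbsRing_NormedModule C_AbsRing) f z l.
Proof.
split; intros [[H1 H2 H3] H]; (split; [split; assumption|]); exact H.
Qed.

Lemma is_Cderive_eps (f : C -> C) (z l : C) :
  is_Cderive f z l <->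
  forall eps : R, (0 < eps)%R -> exists delta : R, (0 < delta)%R /\
    forall h : C, (Cmod h < delta)%R ->
      (Cmod (f (z + h)%C - f z - l * h) <= eps * Cmod h)%R.
Proof.
split.
- intros [_ H] eps He.
  assert (Hz : is_filter_lim (locally (T := AbsRing_UniformSpace C_AbsRing) z) z)
    by (intros P HP; exact HP).
  destruct (H z Hz (mkposreal eps He)) as [d Hd].
  exists d; split; [apply cond_pos|]; intros h Hh.
  assert (Hb : ball (M := AbsRing_UniformSpace C_AbsRing) z d (z + h)).
  { change (Cmod (z + h - z) < d)%R. replace (z + h - z) with h by ring; exact Hh. }
  specialize (Hd _ Hb).
  change (Cmod (f (z + h)%C - f z - (z + h - z) * l) <= eps * Cmod (z + h - z))%R in Hd.
  replace (z + h - z) with h in Hd by ring.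
  rewrite (Cmult_comm l h); exact Hd.
- intros H; split; [apply is_linear_scal_l|].
  intros x Hx.
  assert (E : z = x) by exact (is_filter_lim_locally_unique
    (V := AbsRing_NormedModule C_AbsRing) z x Hx).
  subst x; intros [eps He]; destruct (H eps He) as [d [Hd1 Hd]].
  assert (Hy : forall y : C, (Cmod (y - z) < d)%R ->
    (Cmod (f y - f z - (y - z) * l) <= eps * Cmod (y - z))%R).
  { intros y Hy; specialize (Hd (y - z) Hy).
    replace (z + (y - z)) with y in Hd by ring.
    rewrite (Cmult_comm (y - z) l); exact Hd. }
  exists (mkposreal d Hd1); exact Hy.
Qed.

Lemma is_Cderive_eq (f : C -> C) (z l l' : C) :
  is_Cderive f z l -> l = l' -> is_Cderive f z l'.
Proof. intros H <-; exact H. Qed.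

Lemma is_Cderive_ext_disk (f g : C -> C) (z l : C) :
  (forall w, in_disk w -> f w = g w) -> in_disk z ->
  is_Cderive f z l -> is_Cderive g z l.
Proof.
intros Hfg Hz; apply is_derive_ext_loc.
assert (Hd : (0 < 1 - Cmod z)%R) by (unfold in_disk in Hz; lra).
assert (Hw : forall w : C, (Cmod (w - z) < 1 - Cmod z)%R -> f w = g w).
{ intros w Hw; apply Hfg; unfold in_disk.
  replace w with ((w - z) + z) by ring.
  pose proof (Cmod_triangle (w - z) z); lra. }
exists (mkposreal _ Hd); exact Hw.
Qed.

Lemma is_Cderive_id (z : C) : is_Cderive (fun w => w) z 1.
Proof. apply is_Cderive_AbsRing; exact (is_derive_id (K := C_AbsRing) z). Qed.

Lemma is_Cderive_const (c z : C) : is_Cderive (fun _ => c) z 0.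
Proof. apply (is_derive_const (K := C_AbsRing) (V := C_NormedModule)). Qed.

Lemma is_Cderive_plus (f g : C -> C) (z a b : C) :
  is_Cderive f z a -> is_Cderive g z b ->
  is_Cderive (fun w => f w + g w) z (a + b).
Proof. apply (is_derive_plus (K := C_AbsRing) (V := C_NormedModule)). Qed.

Lemma is_Cderive_mult (f g : C -> C) (z a b : C) :
  is_Cderive f z a -> is_Cderive g z b ->
  is_Cderive (fun w => f w * g w) z (a * g z + f z * b).
Proof.
intros Hf Hg; apply is_Cderive_AbsRing in Hf, Hg; apply is_Cderive_AbsRing.
exact (is_derive_mult (K := C_AbsRing) f g z a b Hf Hg Cmult_comm).
Qed.

Lemma is_Cderive_comp (f g : C -> C) (z a b : C) :
  is_Cderive f (g z) a -> is_Cderive g z b ->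
  is_Cderive (fun w => f (g w)) z (b * a).
Proof.
intros Hf Hg; apply is_Cderive_AbsRing in Hg.
exact (is_derive_comp (K := C_AbsRing) (V := C_NormedModule) f g z a b Hf Hg).
Qed.

Lemma is_Cderive_scal (c : C) (f : C -> C) (z a : C) :
  is_Cderive f z a -> is_Cderive (fun w => c * f w) z (c * a).
Proof.
intros H; eapply is_Cderive_eq.
- apply is_Cderive_mult; [apply is_Cderive_const | exact H].
- cbv beta; ring.
Qed.

Lemma is_Cderive_pow (n : nat) (z : C) :
  is_Cderive (fun w => w ^ n) z (INR n * z ^ pred n).
Proof.
induction n as [|n IH].
- exact (is_Cderive_eq _ _ 0 _ (is_Cderive_const 1 z) (eq_sym (Cmult_0_l _))).
- apply (is_Cderive_eq _ _ (1 * z ^ n + z * (INR n * z ^ pred n))).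
  + exact (is_Cderive_mult _ _ _ _ _ (is_Cderive_id z) IH).
  + rewrite S_INR, RtoC_plus; destruct n; simpl; ring.
Qed.

Lemma is_Cderive_inv (z : C) : z <> 0 -> is_Cderive Cinv z (- / (z * z)).
Proof.
intros Hz; apply is_Cderive_eps; intros eps He.
assert (Hm : (0 < Cmod z)%R) by (apply Cmod_gt_0; exact Hz).
set (m := Cmod z) in *.
(* The first bound keeps |z + h| above m / 2; the error h^2 / (z^2 (z + h)) is then at most 2 |h|^2
   / m^3, which the second bound brings below eps |h|. *)
exists (Rmin (m / 2) (eps * m ^ 3 / 2)); split.
{ apply Rmin_pos; [lra|]. pose proof (pow_lt m 3 Hm). nra. }
intros h Hh.
assert (H1 : (Cmod h < m / 2)%R) by (eapply Rlt_le_trans; [exact Hh | apply Rmin_l]).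
assert (H2 : (Cmod h < eps * m ^ 3 / 2)%R) by (eapply Rlt_le_trans; [exact Hh | apply Rmin_r]).
assert (H3 : (m / 2 < Cmod (z + h))%R).
{ pose proof (Cmod_triangle (z + h) (- h)) as T.
  rewrite Cmod_opp in T; replace (z + h + - h) with z in T by ring. fold m in T; lra. }
assert (Hzh : z + h <> 0) by (apply Cmod_gt_0; lra).
replace (/ (z + h) - / z - - / (z * z) * h) with (h * h / (z * z * (z + h)))
  by (field; split; assumption).
rewrite Cmod_div by (repeat apply Cmult_neq_0; assumption).
rewrite !Cmod_mult; fold m.
pose proof (Cmod_ge_0 h).
apply Rle_div_l; [repeat apply Rmult_lt_0_compat; lra|].
assert (H4 : (Cmod h <= eps * (m * m * Cmod (z + h)))%R).
{ assert (m ^ 3 / 2 <= m * m * Cmod (z + h))%R by (simpl; nra). nra. }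
nra.
Qed.

Lemma is_Cderive_div (f g : C -> C) (z a b : C) :
  is_Cderive f z a -> is_Cderive g z b -> g z <> 0 ->
  is_Cderive (fun w => f w / g w) z ((a * g z - f z * b) / (g z * g z)).
Proof.
intros Hf Hg H0; eapply is_Cderive_eq.
- apply (is_Cderive_mult _ (fun w => / g w)); [exact Hf|].
  apply is_Cderive_comp; [apply is_Cderive_inv; exact H0 | exact Hg].
- cbv beta; field; exact H0.
Qed.

(** * The complex exponential *)

Lemma Cexp_0 : Cexp 0 = 1.
Proof.
unfold Cexp; simpl; rewrite exp_0, cos_0, sin_0, Rmult_1_l, Rmult_0_r; reflexivity.
Qed.

Lemma Cexp_plus (z w : C) : Cexp (z + w) = Cexp z * Cexp w.
Proof.
unfold Cexp, Cmult, Cplus; simpl.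
rewrite exp_plus, cos_plus, sin_plus.
apply injective_projections; unfold Re, Im; simpl; ring.
Qed.

Lemma Cexp_neq_0 (z : C) : Cexp z <> 0.
Proof.
intros H; apply C1_nz.
transitivity (Cexp (z + - z)).
- rewrite Cplus_opp_r, Cexp_0; reflexivity.
- rewrite Cexp_plus, H; ring.
Qed.

Lemma Cmod_Cexp (z : C) : Cmod (Cexp z) = exp (Re z).
Proof.
unfold Cmod, Cexp; simpl.
replace (_ + _)%R with (Rsqr (exp (Re z))).
- apply sqrt_Rsqr, Rlt_le, exp_pos.
- pose proof (sin2_cos2 (Im z)) as H; unfold Rsqr in *.
  transitivity (exp (Re z) * exp (Re z) * (sin (Im z) * sin (Im z) + cos (Im z) * cos (Im z)))%R;
    [rewrite H | idtac]; ring.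
Qed.

Lemma Cmod_le_Rabs (z : C) : (Cmod z <= Rabs (Re z) + Rabs (Im z))%R.
Proof.
destruct z as [x y]; simpl.
replace (x, y) with (RtoC x + RtoC y * Ci).
- eapply Rle_trans; [apply Cmod_triangle|].
  rewrite Cmod_mult, Cmod_Ci, !Cmod_R; lra.
- unfold Cplus, Cmult, RtoC, Ci; simpl; f_equal; ring.
Qed.

Lemma derivable_pt_lim_at_0 (f : R -> R) (l eps : R) :
  derivable_pt_lim f 0 l -> (0 < eps)%R -> exists d : R, (0 < d)%R /\
    forall x, (Rabs x < d)%R -> (Rabs (f x - f 0 - l * x) <= eps * Rabs x)%R.
Proof.
intros H He; destruct (H eps He) as [[d Hd] Hx]; exists d; split; [exact Hd|].
intros x Hxd; destruct (Req_dec x 0) as [->|Hx0].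
- rewrite Rmult_0_r, Rabs_R0, !Rminus_0_r, Rminus_diag, Rabs_R0; lra.
- specialize (Hx x Hx0 Hxd); rewrite Rplus_0_l in Hx.
  replace (f x - f 0 - l * x)%R with (((f x - f 0) / x - l) * x)%R by (field; exact Hx0).
  rewrite Rabs_mult; apply Rmult_le_compat_r; [apply Rabs_pos | lra].
Qed.

(** Only the point 0 needs estimates, from the real first-order expansions of exp, sin and cos; the
    functional equation carries the result to any other point. *)
Lemma is_Cderive_Cexp (z : C) : is_Cderive Cexp z (Cexp z).
Proof.
assert (H0 : is_Cderive Cexp 0 1).
{ apply is_Cderive_eps; intros eps He.
  (* The terms bounded below add up to at most 7 e r, where r = |h|, so a share of eps / 8 suffices.
     The cap 1 / 2 controls the products. *)
  set (e := Rmin (eps / 8) (1 / 2)).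
  assert (He1 : (0 < e)%R) by (apply Rmin_pos; lra).
  assert (He2 : (e <= eps / 8)%R) by apply Rmin_l.
  assert (He3 : (e <= 1 / 2)%R) by apply Rmin_r.
  clearbody e.
  pose proof (derivable_pt_lim_exp 0) as De; rewrite exp_0 in De.
  pose proof (derivable_pt_lim_sin 0) as Ds; rewrite cos_0 in Ds.
  pose proof (derivable_pt_lim_cos 0) as Dc; rewrite sin_0, Ropp_0 in Dc.
  destruct (derivable_pt_lim_at_0 _ _ e De He1) as [d1 [Hd1 E1]].
  destruct (derivable_pt_lim_at_0 _ _ e Ds He1) as [d2 [Hd2 E2]].
  destruct (derivable_pt_lim_at_0 _ _ e Dc He1) as [d3 [Hd3 E3]].
  exists (Rmin e (Rmin d1 (Rmin d2 d3))); split; [repeat apply Rmin_pos; assumption|].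
  intros [x y] Hh.
  pose proof (Rmax_Cmod (x, y)) as HR; simpl in HR.
  pose proof (Rmax_l (Rabs x) (Rabs y)) as Hx.
  pose proof (Rmax_r (Rabs x) (Rabs y)) as Hy.
  set (r := Cmod (x, y)) in *.
  assert (Hr : (r < e /\ r < d1 /\ r < d2 /\ r < d3)%R).
  { repeat split; (eapply Rlt_le_trans; [exact Hh|]).
    - apply Rmin_l.
    - eapply Rle_trans; [apply Rmin_r | apply Rmin_l].
    - eapply Rle_trans; [apply Rmin_r|]; eapply Rle_trans; [apply Rmin_r | apply Rmin_l].
    - eapply Rle_trans; [apply Rmin_r|]; eapply Rle_trans; [apply Rmin_r | apply Rmin_r]. }
  specialize (E1 x ltac:(lra)); specialize (E2 y ltac:(lra)); specialize (E3 y ltac:(lra)).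
  rewrite exp_0 in E1; rewrite sin_0 in E2; rewrite cos_0 in E3.
  eapply Rle_trans; [apply Cmod_le_Rabs|].
  rewrite Cplus_0_l, Cexp_0; unfold Cexp; simpl.
  set (a := (exp x - 1 - 1 * x)%R) in *.
  set (b := (sin y - 0 - 1 * y)%R) in *.
  set (c := (cos y - 1 - 0 * y)%R) in *.
  assert (Ex : exp x = (1 + x + a)%R) by (unfold a; ring).
  assert (Es : sin y = (y + b)%R) by (unfold b; ring).
  assert (Ec : cos y = (1 + c)%R) by (unfold c; ring).
  rewrite Ex, Es, Ec.
  replace (_ + - _ + - _)%R with (a + c + x * c + a * c)%R by ring.
  replace (_ + - _ + - _)%R with (b + x * y + x * b + a * y + a * b)%R by ring.
  pose proof (Rabs_pos x); pose proof (Rabs_pos y); pose proof (Rabs_pos a);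
  pose proof (Rabs_pos b); pose proof (Rabs_pos c).
  assert (T1 : (Rabs (a + c + x * c + a * c) <=
     Rabs a + Rabs c + Rabs x * Rabs c + Rabs a * Rabs c)%R).
  { rewrite <- !Rabs_mult.
    pose proof (Rabs_triang (a + c + x * c) (a * c)).
    pose proof (Rabs_triang (a + c) (x * c)).
    pose proof (Rabs_triang a c). lra. }
  assert (T2 : (Rabs (b + x * y + x * b + a * y + a * b) <= Rabs b + Rabs x * Rabs y +
     Rabs x * Rabs b + Rabs a * Rabs y + Rabs a * Rabs b)%R).
  { rewrite <- !Rabs_mult.
    pose proof (Rabs_triang (b + x * y + x * b + a * y) (a * b)).
    pose proof (Rabs_triang (b + x * y + x * b) (a * y)).
    pose proof (Rabs_triang (b + x * y) (x * b)).
    pose proof (Rabs_triang b (x * y)). lra. }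
  assert (Rabs a <= e * r)%R
    by (eapply Rle_trans; [eassumption | apply Rmult_le_compat_l; lra]).
  assert (Rabs b <= e * r)%R
    by (eapply Rle_trans; [eassumption | apply Rmult_le_compat_l; lra]).
  assert (Rabs c <= e * r)%R
    by (eapply Rle_trans; [eassumption | apply Rmult_le_compat_l; lra]).
  assert (e * r <= 1 / 2 * 1)%R by (apply Rmult_le_compat; lra).
  assert (Rabs x * Rabs c <= 1 / 2 * (e * r))%R by (apply Rmult_le_compat; lra).
  assert (Rabs a * Rabs c <= 1 / 2 * (e * r))%R by (apply Rmult_le_compat; lra).
  assert (Rabs x * Rabs y <= e * r)%R by (apply Rmult_le_compat; lra).
  assert (Rabs x * Rabs b <= 1 / 2 * (e * r))%R by (apply Rmult_le_compat; lra).
  assert (Rabs a * Rabs y <= (e * r) * 1)%R by (apply Rmult_le_compat; lra).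
  assert (Rabs a * Rabs b <= 1 / 2 * (e * r))%R by (apply Rmult_le_compat; lra).
  assert (e * r <= eps / 8 * r)%R by (apply Rmult_le_compat_r; lra).
  lra. }
apply (is_derive_ext (K := C_AbsRing) (V := C_NormedModule)
         (fun w => Cexp z * Cexp (w + - z))).
{ intros t; rewrite <- Cexp_plus; f_equal; ring. }
eapply is_Cderive_eq.
- apply is_Cderive_scal, (is_Cderive_comp Cexp (fun w => w + - z)).
  + rewrite Cplus_opp_r; exact H0.
  + apply is_Cderive_plus; [apply is_Cderive_id | apply is_Cderive_const].
- ring.
Qed.

(** * Complex series and power series *)

Definition is_Cseries (a : nat -> C) (l : C) : Prop :=
  is_series (K := C_AbsRing) (V := C_NormedModule) a l.

Definition Csum (a : nat -> C) (n : nat) : C := sum_n (G := C_AbelianGroup) a n.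

Lemma Csum_0 (a : nat -> C) : Csum a 0 = a 0%nat.
Proof. exact (sum_O (G := C_AbelianGroup) a). Qed.

Lemma Csum_S (a : nat -> C) (n : nat) : Csum a (S n) = Csum a n + a (S n).
Proof. exact (sum_Sn (G := C_AbelianGroup) a n). Qed.

Lemma is_Cseries_eps (a : nat -> C) (l : C) :
  is_Cseries a l <->
  forall eps : R, (0 < eps)%R -> exists N : nat, forall n : nat, (N <= n)%nat ->
    (Cmod (Csum a n - l) < eps)%R.
Proof.
split.
- intros H eps He.
  exact (proj1 (filterlim_locally_ball_norm (U := C_NormedModule) _ l) H (mkposreal eps He)).
- intros H; apply (filterlim_locally_ball_norm (U := C_NormedModule)).
  intros [eps He]; exact (H eps He).
Qed.

Lemma is_Cseries_ext (a b : nat -> C) (l : C) :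
  (forall n, a n = b n) -> is_Cseries a l -> is_Cseries b l.
Proof. apply (is_series_ext (K := C_AbsRing) (V := C_NormedModule)). Qed.

Lemma is_Cseries_eq (a : nat -> C) (l l' : C) :
  is_Cseries a l -> l = l' -> is_Cseries a l'.
Proof. intros H <-; exact H. Qed.

Lemma is_Cseries_unique (a : nat -> C) (l l' : C) :
  is_Cseries a l -> is_Cseries a l' -> l = l'.
Proof.
intros H H'; exact (filterlim_locally_unique (V := C_NormedModule) _ l l' H H').
Qed.

Lemma is_Cseries_plus (a b : nat -> C) (l m : C) :
  is_Cseries a l -> is_Cseries b m -> is_Cseries (fun n => a n + b n) (l + m).
Proof. apply (is_series_plus (K := C_AbsRing) (V := C_NormedModule)). Qed.

Lemma is_Cseries_scal (c : C) (a : nat -> C) (l : C) :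
  is_Cseries a l -> is_Cseries (fun n => c * a n) (c * l).
Proof. apply (is_series_scal (K := C_AbsRing) (V := C_NormedModule)). Qed.

Lemma is_Cseries_incr_1 (a : nat -> C) (l : C) :
  is_Cseries a l -> is_Cseries (fun n => a (S n)) (l - a 0%nat).
Proof.
intros H; apply (is_series_incr_1 (K := C_AbsRing) (V := C_NormedModule) a).
apply (is_Cseries_eq _ _ _ H).
change (l = l - a 0%nat + a 0%nat); ring.
Qed.

Lemma is_Cseries_decr_1 (a : nat -> C) (l : C) :
  is_Cseries (fun n => a (S n)) l -> is_Cseries a (l + a 0%nat).
Proof.
intros H; apply (is_series_decr_1 (K := C_AbsRing) (V := C_NormedModule) a).
apply (is_Cseries_eq _ _ _ H).
change (l = l + a 0%nat + - a 0%nat); ring.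
Qed.

Lemma Re_Csum (a : nat -> C) (n : nat) : Re (Csum a n) = sum_n (fun k => Re (a k)) n.
Proof.
induction n as [|n IH].
- rewrite Csum_0, sum_O; reflexivity.
- rewrite Csum_S, sum_Sn, <- IH; reflexivity.
Qed.

Lemma Im_Csum (a : nat -> C) (n : nat) : Im (Csum a n) = sum_n (fun k => Im (a k)) n.
Proof.
induction n as [|n IH].
- rewrite Csum_0, sum_O; reflexivity.
- rewrite Csum_S, sum_Sn, <- IH; reflexivity.
Qed.

Lemma Rabs_Im_le_Cmod (z : C) : (Rabs (Im z) <= Cmod z)%R.
Proof. eapply Rle_trans; [apply Rmax_r | apply Rmax_Cmod]. Qed.

Lemma is_Cseries_Re_Im (a : nat -> C) (x y : R) :
  is_series (fun n => Re (a n)) x -> is_series (fun n => Im (a n)) y ->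
  is_Cseries a (x, y).
Proof.
intros Hx Hy; apply is_Cseries_eps; intros eps He.
assert (He2 : (0 < eps / 2)%R) by lra.
destruct (proj1 (filterlim_locally_ball_norm _ _) Hx (mkposreal _ He2)) as [N1 H1].
destruct (proj1 (filterlim_locally_ball_norm _ _) Hy (mkposreal _ He2)) as [N2 H2].
exists (Nat.max N1 N2); intros n Hn.
specialize (H1 n ltac:(lia)); specialize (H2 n ltac:(lia)).
change (Rabs (sum_n (fun k => Re (a k)) n - x) < eps / 2)%R in H1.
change (Rabs (sum_n (fun k => Im (a k)) n - y) < eps / 2)%R in H2.
rewrite <- Re_Csum in H1; rewrite <- Im_Csum in H2.
eapply Rle_lt_trans; [apply Cmod_le_Rabs|].
change (Rabs (Re (Csum a n) - x) + Rabs (Im (Csum a n) - y) < eps)%R; lra.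
Qed.

Lemma is_Cseries_of_Cmod (a : nat -> C) :
  ex_series (fun n => Cmod (a n)) ->
  is_Cseries a (Series (fun n => Re (a n)), Series (fun n => Im (a n))).
Proof.
intros H; apply is_Cseries_Re_Im; apply Series_correct;
  apply ex_series_Rabs, (ex_series_le (K := R_AbsRing) (V := R_CompleteNormedModule)
    _ (fun n => Cmod (a n))); try exact H; intros n;
  change (norm ?x) with (Rabs x); rewrite Rabs_Rabsolu.
- apply re_le_Cmod.
- apply Rabs_Im_le_Cmod.
Qed.

Lemma Cmod_Csum_le (a : nat -> C) (b : nat -> R) (n : nat) :
  (forall k, (k <= n)%nat -> (Cmod (a k) <= b k)%R) ->
  (Cmod (Csum a n) <= sum_n b n)%R.
Proof.
induction n as [|n IH]; intros H.
- rewrite Csum_0, sum_O; auto.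
- rewrite Csum_S, sum_Sn; eapply Rle_trans; [apply Cmod_triangle|].
  apply Rplus_le_compat; auto.
Qed.

Lemma sum_n_le_series (b : nat -> R) (m : R) (n : nat) :
  (forall k, (0 <= b k)%R) -> is_series b m -> (sum_n b n <= m)%R.
Proof.
intros Hb H.
apply (is_lim_seq_incr_compare (sum_n b) m H); intros k.
rewrite sum_Sn; specialize (Hb (S k)); change plus with Rplus; lra.
Qed.

Lemma Cmod_series_le (a : nat -> C) (b : nat -> R) (l : C) (m : R) :
  (forall n, (Cmod (a n) <= b n)%R) -> is_Cseries a l -> is_series b m ->
  (Cmod l <= m)%R.
Proof.
intros Hab Ha Hb; apply Rle_plus_epsilon; intros eps He.
destruct (proj1 (is_Cseries_eps a l) Ha eps He) as [N HN].
specialize (HN N (le_n N)).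
assert (H : (sum_n b N <= m)%R).
{ apply sum_n_le_series; [|exact Hb]; intros k.
  eapply Rle_trans; [apply Cmod_ge_0 | apply Hab]. }
pose proof (Cmod_Csum_le a b N (fun k _ => Hab k)).
pose proof (Cmod_triangle (Csum a N) (- (Csum a N - l))) as T.
rewrite Cmod_opp in T.
replace (Csum a N + - (Csum a N - l)) with l in T by ring; lra.
Qed.

Lemma is_Rseries_ext (a b : nat -> R) (l : R) :
  (forall n, a n = b n) -> is_series a l -> is_series b l.
Proof. apply is_series_ext. Qed.

Lemma is_series_lin (a b d : nat -> R) (l m k p q : R) :
  is_series a l -> is_series b m -> is_series d k ->
  is_series (fun n => a n + p * b n + q * d n)%R (l + p * m + q * k)%R.
Proof.
intros Ha Hb Hd.
exact (is_series_plus (K := R_AbsRing) (V := R_NormedModule) _ _ _ _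
  (is_series_plus (K := R_AbsRing) (V := R_NormedModule) _ _ _ _ Ha
    (is_series_scal (K := R_AbsRing) (V := R_NormedModule) p _ _ Hb))
  (is_series_scal (K := R_AbsRing) (V := R_NormedModule) q _ _ Hd)).
Qed.

(** * Power series with radius of convergence at least 1 *)

Definition radius_ge_1 (c : nat -> C) : Prop :=
  forall x : R, (0 <= x < 1)%R -> ex_series (fun n => Cmod (c n) * x ^ n)%R.

Lemma radius_ge_1_CV (c : nat -> C) (x : R) :
  radius_ge_1 c -> (0 <= x < 1)%R ->
  Rbar_lt (Rabs x) (CV_radius (fun n => Cmod (c n))).
Proof.
intros H Hx; rewrite Rabs_pos_eq by lra.
(* The terms are bounded at the midpoint of x and 1, so the radius is at least that midpoint, hence
   strictly greater than x. *)
apply Rbar_lt_le_trans with ((x + 1) / 2)%R; [simpl; lra|].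
assert (Hy : (0 <= (x + 1) / 2 < 1)%R) by lra.
apply (proj1 (CV_radius_bounded (fun n => Cmod (c n)))).
destruct (H _ Hy) as [m Hm]; exists m; intros n.
assert (P : forall k, (0 <= Cmod (c k) * ((x + 1) / 2) ^ k)%R).
{ intros k; apply Rmult_le_pos; [apply Cmod_ge_0 | apply pow_le; lra]. }
rewrite Rabs_pos_eq by apply P.
eapply Rle_trans; [|exact (sum_n_le_series _ _ n P Hm)].
destruct n; [rewrite sum_O; lra|].
rewrite sum_Sn.
assert (0 <= sum_n (fun k => Cmod (c k) * ((x + 1) / 2) ^ k) n)%R.
{ clear - P; induction n as [|n IH]; [rewrite sum_O; apply P|].
  rewrite sum_Sn; apply Rplus_le_le_0_compat; [exact IH | apply P]. }
change plus with Rplus; lra.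
Qed.

Lemma CV_radius_ge_1 (c : nat -> C) :
  (forall x, (0 <= x < 1)%R -> Rbar_lt (Rabs x) (CV_radius (fun n => Cmod (c n)))) ->
  radius_ge_1 c.
Proof.
intros H x Hx; generalize (CV_disk_inside _ _ (H x Hx)); apply ex_series_ext.
intros n; apply Rabs_pos_eq, Rmult_le_pos; [apply Cmod_ge_0 | apply pow_le; lra].
Qed.

Lemma radius_ge_1_bounded (c : nat -> C) (M : R) :
  (forall n, (Cmod (c n) <= M)%R) -> radius_ge_1 c.
Proof.
intros HM x Hx.
apply (ex_series_le (K := R_AbsRing) (V := R_CompleteNormedModule) _ (fun n => M * x ^ n)%R).
- intros n; change (norm ?u) with (Rabs u).
  pose proof (pow_le x n (proj1 Hx)).
  rewrite Rabs_pos_eq by (apply Rmult_le_pos; [apply Cmod_ge_0 | assumption]).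
  apply Rmult_le_compat_r; [assumption | apply HM].
- apply (ex_series_scal (K := R_AbsRing) (V := R_NormedModule)), ex_series_geom.
  rewrite Rabs_pos_eq; lra.
Qed.

(** Summing the two components separately gives a total function; it is the sum of the power series
    wherever that converges absolutely. *)
Definition CPS (c : nat -> C) (z : C) : C :=
  (Series (fun n => Re (c n * z ^ n)), Series (fun n => Im (c n * z ^ n))).

Lemma is_Cseries_CPS (c : nat -> C) (z : C) :
  radius_ge_1 c -> in_disk z -> is_Cseries (fun n => c n * z ^ n) (CPS c z).
Proof.
intros Hc Hz; apply is_Cseries_of_Cmod.
generalize (Hc (Cmod z) (conj (Cmod_ge_0 z) Hz)); apply ex_series_ext.
intros n; rewrite Cmod_mult, Cmod_pow; reflexivity.
Qed.

Definition CPS_derive (c : nat -> C) (n : nat) : C := INR (S n) * c (S n).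

Lemma Cmod_CPS_derive (c : nat -> C) (n : nat) :
  Cmod (CPS_derive c n) = PS_derive (fun n => Cmod (c n)) n.
Proof.
unfold CPS_derive, PS_derive; rewrite Cmod_mult, Cmod_R, Rabs_pos_eq;
  [reflexivity | apply pos_INR].
Qed.

Lemma radius_ge_1_derive (c : nat -> C) : radius_ge_1 c -> radius_ge_1 (CPS_derive c).
Proof.
intros H; apply CV_radius_ge_1; intros x Hx.
rewrite (CV_radius_ext _ (PS_derive (fun n => Cmod (c n))))
  by apply Cmod_CPS_derive.
rewrite CV_radius_derive; apply radius_ge_1_CV; assumption.
Qed.

(** The remainders obey r_(n+1) = (z + h) r_n + n z^(n-1) h^2. The coefficients are nonnegative, so
    the same recurrence in |z| and |h| dominates. *)
Lemma Cpow_taylor_1 (z h : C) (n : nat) :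
  (Cmod ((z + h) ^ n - z ^ n - INR n * z ^ pred n * h) <=
   (Cmod z + Cmod h) ^ n - Cmod z ^ n - INR n * Cmod z ^ pred n * Cmod h)%R.
Proof.
pose proof (Cmod_ge_0 z) as Hz; pose proof (Cmod_ge_0 h) as Hh.
induction n as [|n IH].
- simpl. replace (1 - 1 - 0 * 1 * h) with (RtoC 0) by ring.
  rewrite Cmod_0; lra.
- set (r := (z + h) ^ n - z ^ n - INR n * z ^ pred n * h) in IH.
  set (s := ((Cmod z + Cmod h) ^ n - Cmod z ^ n - INR n * Cmod z ^ pred n * Cmod h)%R) in IH.
  replace ((z + h) ^ S n - z ^ S n - INR (S n) * z ^ pred (S n) * h)
    with ((z + h) * r + INR n * z ^ pred n * (h * h)).
  2: { unfold r; rewrite S_INR, RtoC_plus, !Cpow_S; destruct n; simpl; ring. }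
  replace ((Cmod z + Cmod h) ^ S n - Cmod z ^ S n - INR (S n) * Cmod z ^ pred (S n) * Cmod h)%R
    with ((Cmod z + Cmod h) * s + INR n * Cmod z ^ pred n * (Cmod h * Cmod h))%R.
  2: { unfold s; rewrite S_INR; destruct n; simpl; ring. }
  eapply Rle_trans; [apply Cmod_triangle|].
  rewrite !Cmod_mult, Cmod_pow, Cmod_R, (Rabs_pos_eq (INR n)) by apply pos_INR.
  apply Rplus_le_compat_r, Rmult_le_compat; try apply Cmod_ge_0;
    [apply Cmod_triangle | exact IH].
Qed.

(* The first-order Taylor remainder of [z ^ n] is dominated by that of the real
   [x ^ n] at [x = |z|], so differentiability follows from that of the real
   power series with coefficients [|c n|]. *)
Lemma is_Cderive_CPS (c : nat -> C) (z : C) :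
  radius_ge_1 c -> in_disk z -> is_Cderive (CPS c) z (CPS (CPS_derive c) z).
Proof.
intros Hc Hz; apply is_Cderive_eps; intros eps He.
set (x := Cmod z); set (b := fun n => Cmod (c n)).
assert (Hx : (0 <= x < 1)%R) by (split; [apply Cmod_ge_0 | exact Hz]).
pose proof (is_derive_PSeries b x (radius_ge_1_CV c x Hc Hx)) as HD.
apply is_derive_Reals in HD; destruct (HD eps He) as [[d Hd] HD'].
exists (Rmin d (1 - x)); split; [apply Rmin_pos; lra|]; intros h Hh.
assert (Hh1 : (Cmod h < d)%R) by (eapply Rlt_le_trans; [exact Hh | apply Rmin_l]).
assert (Hh2 : (Cmod h < 1 - x)%R) by (eapply Rlt_le_trans; [exact Hh | apply Rmin_r]).
pose proof (Cmod_ge_0 h) as Hh0.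
assert (Hzh : in_disk (z + h)).
{ unfold in_disk; pose proof (Cmod_triangle z h); fold x in H; lra. }
assert (PS : forall (y : R) (a : nat -> R), Rbar_lt (Rabs y) (CV_radius a) ->
  is_series (fun n => a n * y ^ n)%R (PSeries a y)).
{ intros y a Hy; apply Series_correct, ex_series_Rabs, CV_disk_inside, Hy. }
assert (Hder : is_Cseries (fun n => c n * (INR n * z ^ pred n)) (CPS (CPS_derive c) z)).
{ eapply is_Cseries_eq.
  - apply is_Cseries_decr_1; eapply is_Cseries_ext;
      [|exact (is_Cseries_CPS _ z (radius_ge_1_derive c Hc) Hz)].
    intros n; unfold CPS_derive; simpl pred; ring.
  - simpl; ring. }
assert (HR : is_series
   (fun n => b n * ((x + Cmod h) ^ n - x ^ n - INR n * x ^ pred n * Cmod h))%R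
   (PSeries b (x + Cmod h) - PSeries b x - PSeries (PS_derive b) x * Cmod h)%R).
{ assert (Hd1 : is_series (fun n => b n * (INR n * x ^ pred n))%R (PSeries (PS_derive b) x)).
  { apply (is_series_decr_1 (K := R_AbsRing) (V := R_NormedModule)).
    replace (plus _ _) with (PSeries (PS_derive b) x)
      by (change plus with Rplus; change opp with Ropp; simpl; ring).
    eapply is_series_ext; [|apply (PS x (PS_derive b))].
    - intros n; unfold PS_derive; simpl pred; simpl; ring.
    - rewrite CV_radius_derive; apply radius_ge_1_CV; assumption. }
  pose proof (is_series_lin _ _ _ _ _ _ (-1) (- Cmod h)
    (PS (x + Cmod h)%R b (radius_ge_1_CV c (x + Cmod h) Hc ltac:(lra)))
    (PS x b (radius_ge_1_CV c _ Hc Hx)) Hd1) as H.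
  replace (PSeries b (x + Cmod h) - PSeries b x - PSeries (PS_derive b) x * Cmod h)%R
    with (PSeries b (x + Cmod h) + -1 * PSeries b x + - Cmod h * PSeries (PS_derive b) x)%R
    by ring.
  revert H; apply is_Rseries_ext; intros n; ring. }
assert (HC : is_Cseries
   (fun n => c n * ((z + h) ^ n - z ^ n - INR n * z ^ pred n * h))
   (CPS c (z + h) - CPS c z - CPS (CPS_derive c) z * h)).
{ eapply is_Cseries_ext.
  2: eapply is_Cseries_eq; [apply is_Cseries_plus;
       [apply is_Cseries_plus;
         [exact (is_Cseries_CPS c _ Hc Hzh)
         | exact (is_Cseries_scal (-(1)) _ _ (is_Cseries_CPS c _ Hc Hz))]
       | exact (is_Cseries_scal (- h) _ _ Hder)] | ring].
  intros n; cbv beta; ring. }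
eapply Rle_trans; [eapply Cmod_series_le; [|exact HC|exact HR]|].
- intros n; cbv beta; rewrite Cmod_mult; apply Rmult_le_compat_l; [apply Cmod_ge_0|].
  apply Cpow_taylor_1.
(* The real difference quotient is controlled only for nonzero increments, so |h| = 0 is treated
   apart. *)
- destruct (Req_dec (Cmod h) 0) as [E|E].
  + rewrite E, Rplus_0_r, !Rmult_0_r, Rminus_0_r, Rminus_diag; lra.
  + specialize (HD' (Cmod h) E ltac:(rewrite Rabs_pos_eq; simpl; lra)).
    apply Rlt_le in HD'; apply (Rmult_le_compat_r (Cmod h) _ _ Hh0) in HD'.
    eapply Rle_trans; [|exact HD'].
    eapply Rle_trans; [|apply Rmult_le_compat_r; [exact Hh0 | apply Rle_abs]].
    apply Req_le; field; exact E.
Qed.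

(** * Logarithmic and binomial series *)

Lemma derivable_pt_lim_Re_ray (F : C -> C) (z l : C) (t : R) :
  is_Cderive F (t * z) l ->
  derivable_pt_lim (fun s => Re (F (s * z)%C)) t (Re (l * z)).
Proof.
intros H eps He.
pose proof (Cmod_ge_0 z) as Hz.
(* The + 1 keeps the quotient meaningful when z = 0. *)
assert (He' : (0 < eps / (2 * (Cmod z + 1)))%R) by (apply Rdiv_lt_0_compat; lra).
destruct (proj1 (is_Cderive_eps _ _ _) H _ He') as [d [Hd HF]].
assert (Hd' : (0 < d / (Cmod z + 1))%R) by (apply Rdiv_lt_0_compat; lra).
exists (mkposreal _ Hd'); intros s Hs Hsd; simpl in Hsd; cbv beta.
assert (Hsz : (Cmod (s * z) < d)%R).
{ rewrite Cmod_mult, Cmod_R.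
  apply (Rlt_div_r _ _ (Cmod z + 1)) in Hsd; [|lra].
  pose proof (Rabs_pos s); nra. }
specialize (HF _ Hsz).
replace (t * z + s * z) with (RtoC (t + s) * z) in HF by (rewrite RtoC_plus; ring).
assert (HR : (Rabs (Re (F (RtoC (t + s) * z)%C) - Re (F (t * z)%C) - Re (l * z) * s) <=
   eps / (2 * (Cmod z + 1)) * Cmod (s * z))%R).
{ eapply Rle_trans; [|exact HF]; eapply Rle_trans; [|apply re_le_Cmod].
  apply Req_le; f_equal.
  destruct (F (RtoC (t + s) * z)%C), (F (t * z)), l, z; unfold Re; simpl; ring. }
replace ((Re (F (RtoC (t + s) * z)%C) - Re (F (t * z)%C)) / s - Re (l * z))%R
  with ((Re (F (RtoC (t + s) * z)%C) - Re (F (t * z)%C) - Re (l * z) * s) / s)%R by (field; exact Hs).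
pose proof (Rabs_pos_lt s Hs) as Hs0.
rewrite Rabs_div by exact Hs; apply Rlt_div_l; [exact Hs0|].
eapply Rle_lt_trans; [exact HR|]; rewrite Cmod_mult, Cmod_R.
replace (eps / (2 * (Cmod z + 1)) * (Rabs s * Cmod z))%R
  with (eps * Rabs s * (Cmod z / (2 * (Cmod z + 1))))%R by (field; lra).
assert (Cmod z / (2 * (Cmod z + 1)) < 1)%R by (apply Rlt_div_l; lra).
assert (0 < eps * Rabs s)%R by (apply Rmult_lt_0_compat; lra).
nra.
Qed.

Lemma Re_mult_opp_Ci (z : C) : Re (- Ci * z) = Im z.
Proof. destruct z; unfold Re, Im; simpl; ring. Qed.

Lemma derivable_pt_lim_ext (f g : R -> R) (x l : R) :
  (forall t, f t = g t) -> derivable_pt_lim f x l -> derivable_pt_lim g x l.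
Proof.
intros H Hf; apply is_derive_Reals; apply is_derive_Reals in Hf.
revert Hf; apply is_derive_ext; exact H.
Qed.

(** Multiplication by [- Ci] turns imaginary parts into real parts and reduces this to the preceding
    case. *)
Lemma derivable_pt_lim_Im_ray (F : C -> C) (z l : C) (t : R) :
  is_Cderive F (t * z) l ->
  derivable_pt_lim (fun s => Im (F (s * z))) t (Im (l * z)).
Proof.
intros H; rewrite <- Re_mult_opp_Ci, Cmult_assoc.
apply (derivable_pt_lim_ext (fun s => Re (- Ci * F (s * z)))).
{ intros s; apply Re_mult_opp_Ci. }
apply (derivable_pt_lim_Re_ray (fun w => - Ci * F w)), is_Cderive_scal, H.
Qed.

Lemma null_derivative_0_1 (g : R -> R) :
  (forall t, (0 <= t <= 1)%R -> derivable_pt_lim g t 0) -> g 1%R = g 0%R.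
Proof.
intros H; destruct (MVT_cor2 g (fun _ => 0%R) 0 1 Rlt_0_1 H) as [c [E _]]; lra.
Qed.

Lemma in_disk_ray (z : C) (t : R) : (0 <= t <= 1)%R -> in_disk z -> in_disk (t * z).
Proof.
unfold in_disk; intros Ht Hz; rewrite Cmod_mult, Cmod_R, Rabs_pos_eq by lra.
pose proof (Cmod_ge_0 z); nra.
Qed.

(** The disk is star-shaped about 0: on the segment from 0 to z the mean value theorem applies to
    the real and imaginary parts. *)
Lemma null_Cderive_disk (F : C -> C) :
  (forall z, in_disk z -> is_Cderive F z 0) -> forall z, in_disk z -> F z = F 0.
Proof.
intros H z Hz.
assert (HR : Re (F (1%R * z)) = Re (F (0%R * z))).
{ apply (null_derivative_0_1 (fun t => Re (F (t * z)%C))); intros t Ht.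
  replace 0%R with (Re (0 * z)) by (unfold Re; simpl; ring).
  apply derivable_pt_lim_Re_ray, H, in_disk_ray; assumption. }
assert (HI : Im (F (1%R * z)) = Im (F (0%R * z))).
{ apply (null_derivative_0_1 (fun t => Im (F (t * z)))); intros t Ht.
  replace 0%R with (Im (0 * z)) by (unfold Im; simpl; ring).
  apply derivable_pt_lim_Im_ray, H, in_disk_ray; assumption. }
rewrite Cmult_1_l, Cmult_0_l in HR, HI.
apply injective_projections; assumption.
Qed.

Lemma in_disk_0 : in_disk 0.
Proof. unfold in_disk; rewrite Cmod_0; lra. Qed.

Lemma CPS_0 (c : nat -> C) : radius_ge_1 c -> CPS c 0 = c 0%nat.
Proof.
intros Hc; apply (is_Cseries_unique _ _ _ (is_Cseries_CPS c 0 Hc in_disk_0)).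
apply (is_Cseries_eq _ (0 + c 0%nat * 0 ^ 0)); [|simpl; ring].
apply (is_Cseries_decr_1 (fun n => c n * 0 ^ n)), is_Cseries_eps; intros eps He.
exists 0%nat; intros n _.
replace (Csum _ n) with (RtoC 0).
- replace (0 - 0) with (RtoC 0) by ring; rewrite Cmod_0; exact He.
- induction n as [|n IH]; [rewrite Csum_0 | rewrite Csum_S, <- IH]; simpl; ring.
Qed.

Lemma one_plus_neq_0 (v : C) : in_disk v -> 1 + v <> 0.
Proof.
intros H E; assert (v = - (1)) as -> by (rewrite <- (Cplus_0_l (-(1))), <- E; ring).
unfold in_disk in H; rewrite Cmod_m1 in H; lra.
Qed.

(** For B <> 0 these are the Taylor coefficients of (beta / B) log (1 + B u); at B = 0 they reduce
    to those of beta u. *)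
Definition lam_coeff (beta : C) (B : R) (n : nat) : C :=
  match n with O => 0 | S m => beta * RtoC (- B) ^ m / INR (S m) end.

(** For B <> 0 these are the Taylor coefficients of (1 + B u)^(beta / B), at B = 0 those of exp
    (beta u). The recurrence is the differential equation (1 + B u) Y' = beta Y read off
    coefficientwise. *)
Definition binom_coeff (beta : C) (B : R) : nat -> C :=
  fix b n := match n with
    | O => RtoC 1
    | S m => (beta - B * INR m) / INR (S m) * b m
    end.

Lemma lam_coeff_S (beta : C) (B : R) (n : nat) :
  lam_coeff beta B (S n) = beta * RtoC (- B) ^ n / INR (S n).
Proof. reflexivity. Qed.

Lemma binom_coeff_S (beta : C) (B : R) (n : nat) :
  binom_coeff beta B (S n) = (beta - B * INR n) / INR (S n) * binom_coeff beta B n.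
Proof. reflexivity. Qed.

Lemma INR_S_neq_0 (n : nat) : RtoC (INR (S n)) <> 0.
Proof. intros H; apply RtoC_inj in H; revert H; apply not_0_INR; lia. Qed.

Lemma in_disk_scal (B : R) (u : C) : (Rabs B < 1)%R -> in_disk u -> in_disk (B * u).
Proof.
unfold in_disk; intros HB Hu; rewrite Cmod_mult, Cmod_R.
pose proof (Cmod_ge_0 u); pose proof (Rabs_pos B); nra.
Qed.

Lemma Cmod_pow_opp_le_1 (B : R) (n : nat) :
  (Rabs B < 1)%R -> (Cmod (RtoC (- B) ^ n) <= 1)%R.
Proof.
intros HB.
rewrite Cmod_pow, Cmod_R, Rabs_Ropp.
rewrite <- (pow1 n); apply pow_incr; split; [apply Rabs_pos | lra].
Qed.

Lemma radius_lam (beta : C) (B : R) :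
  (Rabs B < 1)%R -> radius_ge_1 (lam_coeff beta B).
Proof.
intros HB.
apply (radius_ge_1_bounded _ (Cmod beta)); intros [|n].
- simpl; rewrite Cmod_0; apply Cmod_ge_0.
- rewrite lam_coeff_S, Cmod_div by apply INR_S_neq_0.
  rewrite Cmod_mult, Cmod_R, Rabs_pos_eq by apply pos_INR.
  pose proof (Cmod_pow_opp_le_1 B n HB) as H1; pose proof (Cmod_ge_0 beta).
  assert (1 <= INR (S n))%R by (apply (le_INR 1); lia).
  pose proof (Cmod_ge_0 (RtoC (- B) ^ n)).
  apply Rle_div_l; [lra|].
  apply Rmult_le_compat_l; lra.
Qed.

Lemma lam_derive_coeff (beta : C) (B : R) (n : nat) :
  CPS_derive (lam_coeff beta B) n = beta * RtoC (- B) ^ n.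
Proof.
unfold CPS_derive; rewrite lam_coeff_S; field; apply INR_S_neq_0.
Qed.

(** The differentiated series is geometric with ratio - B u, so its sum s satisfies s = beta - B u
    s, which is solved for s. *)
Lemma lam_derive (beta : C) (B : R) (u : C) : (Rabs B < 1)%R -> in_disk u ->
  is_Cderive (CPS (lam_coeff beta B)) u (beta / (1 + B * u)).
Proof.
intros HB Hu; pose proof (radius_lam beta B HB) as Hrad.
pose proof (is_Cderive_CPS _ u Hrad Hu) as H.
apply (is_Cderive_eq _ _ _ _ H).
pose proof (is_Cseries_CPS _ u (radius_ge_1_derive _ Hrad) Hu) as H1.
set (s := CPS _ u) in *; clearbody s.
assert (E : s = - B * u * s + beta).
{ apply (is_Cseries_unique _ _ _ H1).
  pose proof (is_Cseries_decr_1 (fun n => CPS_derive (lam_coeff beta B) n * u ^ n)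
    (- B * u * s)) as H2.
  eapply is_Cseries_eq; [apply H2|].
  - eapply is_Cseries_ext; [|exact (is_Cseries_scal (- B * u) _ _ H1)].
    intros n; cbv beta; rewrite !lam_derive_coeff, !Cpow_S, RtoC_opp; ring.
  - cbv beta; rewrite lam_derive_coeff; simpl; ring. }
pose proof (one_plus_neq_0 _ (in_disk_scal B u HB Hu)) as Hne.
assert (Eb : beta = s * (1 + B * u)).
{ transitivity (s - - B * u * s); [rewrite E at 1; ring | ring]. }
rewrite Eb.
field; exact Hne.
Qed.

Lemma eventually_bounded (v : nat -> R) (N : nat) (M0 : R) :
  (forall n, (N <= n)%nat -> (v n <= M0)%R) -> exists M : R, forall n, (v n <= M)%R.
Proof.
revert M0; induction N as [|N IH]; intros M0 H.
- exists M0; intros n; apply H; lia.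
- apply (IH (Rmax M0 (v N))); intros n Hn.
  destruct (Nat.eq_dec n N) as [->|Hn']; [apply Rmax_r|].
  eapply Rle_trans; [apply H; lia | apply Rmax_l].
Qed.

Lemma eventually_decr_bounded (v : nat -> R) (N : nat) :
  (forall n, (N <= n)%nat -> (v (S n) <= v n)%R) ->
  exists M : R, forall n, (v n <= M)%R.
Proof.
intros H; apply (eventually_bounded v N (v N)); intros n Hn.
induction Hn as [|n Hn IH]; [lra|].
eapply Rle_trans; [apply H; exact Hn | exact IH].
Qed.

(** The ratio of consecutive moduli is at most (|beta| + |B| n) / (n + 1), which is at most 1 once n
    (1 - |B|) >= |beta|. The moduli eventually decrease, hence are bounded. *)
Lemma radius_binom (beta : C) (B : R) :
  (Rabs B < 1)%R -> radius_ge_1 (binom_coeff beta B).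
Proof.
intros HB.
destruct (INR_unbounded (Cmod beta / (1 - Rabs B))) as [N HN].
apply Rlt_div_l in HN; [|lra].
destruct (eventually_decr_bounded (fun n => Cmod (binom_coeff beta B n)) N) as [M HM].
- intros n Hn; rewrite binom_coeff_S.
  rewrite Cmod_mult, Cmod_div by apply INR_S_neq_0.
  rewrite Cmod_R, (Rabs_pos_eq (INR (S n))) by apply pos_INR.
  assert (HS : (0 < INR (S n))%R) by (apply lt_0_INR; lia).
  assert (H1 : (Cmod (beta - B * INR n) / INR (S n) <= 1)%R).
  { apply Rle_div_l; [exact HS|].
    eapply Rle_trans; [apply Cmod_triangle|].
    rewrite Cmod_opp, Cmod_mult, !Cmod_R, (Rabs_pos_eq (INR n)) by apply pos_INR.
    apply le_INR in Hn; rewrite S_INR; pose proof (Rabs_pos B); nra. }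
  pose proof (Cmod_ge_0 (binom_coeff beta B n)); nra.
- exact (radius_ge_1_bounded _ M HM).
Qed.

Lemma binom_ode (beta : C) (B : R) (u : C) : (Rabs B < 1)%R -> in_disk u ->
  (1 + B * u) * CPS (CPS_derive (binom_coeff beta B)) u =
  beta * CPS (binom_coeff beta B) u.
Proof.
intros HB Hu.
pose proof (is_Cseries_CPS _ u (radius_binom beta B HB) Hu) as H0.
pose proof (is_Cseries_CPS _ u (radius_ge_1_derive _ (radius_binom beta B HB)) Hu) as H1.
set (s := CPS (CPS_derive _) u) in *; set (y := CPS _ u) in *; clearbody s y.
assert (H2 : is_Cseries (fun n => INR n * binom_coeff beta B n * u ^ n) (u * s)).
{ eapply is_Cseries_eq; [apply is_Cseries_decr_1 |].
  - eapply is_Cseries_ext; [|exact (is_Cseries_scal u _ _ H1)].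
    intros n; unfold CPS_derive; rewrite Cpow_S; ring.
  - simpl; ring. }
assert (E : s = beta * y + - B * (u * s)).
{ apply (is_Cseries_unique _ _ _ H1).
  eapply is_Cseries_ext; [|exact (is_Cseries_plus _ _ _ _
    (is_Cseries_scal beta _ _ H0) (is_Cseries_scal (- B) _ _ H2))].
  intros n; unfold CPS_derive; rewrite binom_coeff_S; field; apply INR_S_neq_0. }
transitivity (s - - B * (u * s)); [ring | rewrite E at 1; ring].
Qed.

(** Y exp (- Lambda) has derivative zero by the differential equation, and its value at 0 is 1. *)
Lemma binom_exp_lam (beta : C) (B : R) (u : C) : (Rabs B < 1)%R -> in_disk u ->
  CPS (binom_coeff beta B) u = Cexp (CPS (lam_coeff beta B) u).
Proof.
intros HB Hu.
set (F := fun w => CPS (binom_coeff beta B) w * Cexp (- (1) * CPS (lam_coeff beta B) w)).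
assert (HF : F u = F 0).
{ apply null_Cderive_disk; [|exact Hu]; intros w Hw.
  eapply is_Cderive_eq.
  - apply is_Cderive_mult; [apply (is_Cderive_CPS _ w (radius_binom beta B HB) Hw)|].
    apply (is_Cderive_comp Cexp); [apply is_Cderive_Cexp|].
    apply is_Cderive_scal, lam_derive; assumption.
  - cbv beta.
    pose proof (one_plus_neq_0 _ (in_disk_scal B w HB Hw)) as Hne.
    pose proof (binom_ode beta B w HB Hw) as E.
    replace (CPS (CPS_derive (binom_coeff beta B)) w)
      with (beta * CPS (binom_coeff beta B) w / (1 + B * w)) by
      (rewrite <- E; field; exact Hne).
    field; exact Hne. }
unfold F in HF.
rewrite (CPS_0 _ (radius_binom beta B HB)), (CPS_0 _ (radius_lam beta B HB)) in HF; simpl in HF.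
rewrite Cmult_0_r, Cexp_0, Cmult_1_r in HF.
transitivity (CPS (binom_coeff beta B) u * Cexp (-(1) * CPS (lam_coeff beta B) u)
   * Cexp (CPS (lam_coeff beta B) u)).
- rewrite <- Cmult_assoc, <- Cexp_plus.
  replace (_ + _) with (RtoC 0) by ring; rewrite Cexp_0; ring.
- rewrite HF; ring.
Qed.

(** In the right half-plane acos (x / r) = atan (|y| / x), and the sign of y decides between the two
    branches of [Carg]. The arctangent form is the one that can be differentiated along rays. *)
Lemma Carg_atan (w : C) : (0 < Re w)%R -> Carg w = atan (Im w / Re w).
Proof.
intros Hx; destruct w as [x y]; simpl in *.
assert (Hr : (0 < Cmod (x, y))%R).
{ eapply Rlt_le_trans; [exact Hx|]; eapply Rle_trans; [apply Rle_abs|].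
  exact (re_le_Cmod (x, y)). }
set (r := Cmod (x, y)) in *.
assert (Er : (r * r = x * x + y * y)%R).
{ pose proof (Cmod2_alt (x, y)) as E; fold r in E; simpl in E; lra. }
assert (E : acos (x / r) = atan (Rabs y / x)).
{ rewrite acos_atan by (apply Rdiv_lt_0_compat; lra).
  f_equal.
  replace (1 - (x / r)²)%R with ((y / r)²)%R.
  - rewrite sqrt_Rsqr_abs, Rabs_div, (Rabs_pos_eq r) by lra. field; lra.
  - unfold Rsqr; replace (1 - x / r * (x / r))%R with ((r * r - x * x) / (r * r))%R by (field; lra).
    replace (r * r - x * x)%R with (y * y)%R by lra; field; lra. }
unfold Carg; simpl; fold r; rewrite E; destruct (Rle_dec 0 y) as [Hy|Hy].
- rewrite Rabs_pos_eq; [reflexivity | exact Hy].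
- rewrite Rabs_left, <- atan_opp by lra; f_equal; field; lra.
Qed.

(* Real and imaginary parts are compared along each ray [t |-> t u], where the
   real derivatives of both sides agree. *)
Lemma CLog_lam (B : R) (u : C) : (Rabs B < 1)%R -> in_disk u ->
  CLog (1 + B * u) = CPS (lam_coeff B B) u.
Proof.
intros HB Hu.
set (a := Re (B * u)); set (b := Im (B * u)).
(* Since |Re (B u)| < 1, the segment 1 + t B u stays in the right half-plane, away from the cut of
   the principal argument. *)
assert (Ha : (Rabs a < 1)%R).
{ eapply Rle_lt_trans; [apply re_le_Cmod | exact (in_disk_scal B u HB Hu)]. }
apply Rabs_def2 in Ha.
assert (Hpos : forall t, (0 <= t <= 1)%R -> (0 < 1 + t * a)%R) by (intros t Ht; nra).
assert (HN : forall t, (0 <= t <= 1)%R -> (0 < (1 + t * a) * (1 + t * a) + t * b * (t * b))%R).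
{ intros t Ht; pose proof (Hpos t Ht); nra. }
assert (Ew : forall t : R, 1 + B * (t * u) = (1 + t * a, t * b)%R).
{ intros t; unfold a, b; destruct u; apply injective_projections; simpl; ring. }
(* The two components are the t-derivatives of the logarithm of the modulus and of the argument of 1
   + t B u. *)
assert (Ed : forall t, (0 <= t <= 1)%R -> B / (1 + B * (t * u)) * u =
  ((a * (1 + t * a) + t * b * b) / ((1 + t * a) * (1 + t * a) + t * b * (t * b)),
   b / ((1 + t * a) * (1 + t * a) + t * b * (t * b)))%R).
{ intros t Ht.
  pose proof (HN t Ht) as H1.
  transitivity ((a, b) / (1 + t * a, t * b)%R).
  - rewrite Ew; replace (a, b) with (B * u) by
      (unfold a, b; destruct u; apply injective_projections; reflexivity).
    unfold Cdiv; ring.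
  - unfold Cdiv, Cinv, Cmult; simpl; apply injective_projections; simpl; field; lra. }
pose proof (radius_lam B B HB) as Hrad.
assert (E0 : CPS (lam_coeff B B) (0%R * u) = 0) by
  (rewrite Cmult_0_l, (CPS_0 _ Hrad); reflexivity).
assert (HRe : Re (CPS (lam_coeff B B) u) = (/ 2 * ln ((1 + a) * (1 + a) + b * b))%R).
{ pose (g := fun t : R => (Re (CPS (lam_coeff B B) (t * u)) +
     - (/ 2 * ln ((1 + t * a) * (1 + t * a) + t * b * (t * b))))%R).
  assert (Hg : g 1%R = g 0%R).
  { apply null_derivative_0_1; intros t Ht.
    pose proof (lam_derive B B (t * u) HB (in_disk_ray u t Ht Hu)) as H1.
    apply derivable_pt_lim_Re_ray in H1; rewrite (Ed t Ht) in H1; simpl in H1.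
    pose proof (HN t Ht) as H2.
    assert (H3 : is_derive (fun t => - (/ 2 * ln ((1 + t * a) * (1 + t * a) + t * b * (t * b))))%R t
      (- ((a * (1 + t * a) + t * b * b) / ((1 + t * a) * (1 + t * a) + t * b * (t * b))))%R).
    { auto_derive; [exact H2 | field; lra]. }
    apply is_derive_Reals in H3.
    pose proof (derivable_pt_lim_plus _ _ _ _ _ H1 H3) as H4.
    rewrite Rplus_opp_r in H4; exact H4. }
  unfold g in Hg; rewrite E0, Cmult_1_l in Hg; change (Re 0) with 0%R in Hg.
  replace ((1 + 1 * a) * (1 + 1 * a) + 1 * b * (1 * b))%R
    with ((1 + a) * (1 + a) + b * b)%R in Hg by ring.
  replace ((1 + 0 * a) * (1 + 0 * a) + 0 * b * (0 * b))%R with 1%R in Hg by ring.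
  rewrite ln_1 in Hg; lra. }
assert (HIm : Im (CPS (lam_coeff B B) u) = atan (b / (1 + a))%R).
{ pose (g := fun t : R => (Im (CPS (lam_coeff B B) (t * u)) +
     - atan (t * b / (1 + t * a)))%R).
  assert (Hg : g 1%R = g 0%R).
  { apply null_derivative_0_1; intros t Ht.
    pose proof (lam_derive B B (t * u) HB (in_disk_ray u t Ht Hu)) as H1.
    apply derivable_pt_lim_Im_ray in H1; rewrite (Ed t Ht) in H1; simpl in H1.
    pose proof (HN t Ht) as H2; pose proof (Hpos t Ht) as H2'.
    assert (H3 : is_derive (fun t => - atan (t * b / (1 + t * a)))%R t
      (- (b / ((1 + t * a) * (1 + t * a) + t * b * (t * b))))%R).
    { auto_derive; [lra | unfold Rsqr; field; repeat split; try lra]. }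
    apply is_derive_Reals in H3.
    pose proof (derivable_pt_lim_plus _ _ _ _ _ H1 H3) as H4.
    rewrite Rplus_opp_r in H4; exact H4. }
  unfold g in Hg; rewrite E0, Cmult_1_l in Hg; change (Im 0) with 0%R in Hg.
  replace (1 * b / (1 + 1 * a))%R with (b / (1 + a))%R in Hg by (rewrite !Rmult_1_l; reflexivity).
  replace (0 * b / (1 + 0 * a))%R with 0%R in Hg by (unfold Rdiv; ring).
  rewrite atan_0 in Hg; lra. }
pose proof (Ew 1%R) as E1; rewrite Cmult_1_l, !Rmult_1_l in E1; rewrite E1.
specialize (Hpos 1%R ltac:(lra)); specialize (HN 1%R ltac:(lra)); rewrite !Rmult_1_l in Hpos, HN.
unfold CLog; rewrite Carg_atan by exact Hpos.
apply injective_projections; [|symmetry; exact HIm].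
transitivity (/ 2 * ln ((1 + a) * (1 + a) + b * b))%R; [|symmetry; exact HRe].
simpl; unfold Cmod; simpl; rewrite !Rmult_1_r.
set (N := ((1 + a) * (1 + a) + b * b)%R) in *.
assert (HN' : (0 < N)%R) by (unfold N; lra).
pose proof (sqrt_lt_R0 N HN') as Hs.
rewrite <- (sqrt_sqrt N) at 2 by lra; rewrite ln_mult by assumption; lra.
Qed.

(** * The extremal function *)

Lemma in_disk_pow (z : C) (m : nat) : (1 <= m)%nat -> in_disk z -> in_disk (z ^ m).
Proof.
unfold in_disk; intros Hm Hz; rewrite Cmod_pow; destruct m as [|m]; [lia|].
rewrite <- tech_pow_Rmult.
pose proof (Cmod_ge_0 z) as H0.
assert (Cmod z ^ m <= 1)%R by (rewrite <- (pow1 m); apply pow_incr; lra).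
pose proof (pow_le _ m H0); nra.
Qed.

Lemma CPS_lam_scal (beta : C) (B : R) (u : C) :
  (Rabs B < 1)%R -> B <> 0%R -> in_disk u ->
  CPS (lam_coeff beta B) u = beta / B * CPS (lam_coeff B B) u.
Proof.
intros HB HB0 Hu.
assert (HB0' : RtoC B <> 0) by (intros E; apply HB0, RtoC_inj, E).
apply (is_Cseries_unique _ _ _ (is_Cseries_CPS _ u (radius_lam beta B HB) Hu)).
eapply is_Cseries_ext;
  [|exact (is_Cseries_scal (beta / B) _ _ (is_Cseries_CPS _ u (radius_lam B B HB) Hu))].
intros [|n]; [simpl; ring|]; rewrite !lam_coeff_S; field.
split; [apply INR_S_neq_0 | exact HB0'].
Qed.

Lemma CPS_lam_B_0 (beta u : C) : in_disk u -> CPS (lam_coeff beta 0) u = beta * u.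
Proof.
intros Hu.
assert (H0 : (Rabs 0 < 1)%R) by (rewrite Rabs_R0; lra).
assert (E : CPS (lam_coeff beta 0) u + - beta * u = CPS (lam_coeff beta 0) 0 + - beta * 0).
{ apply (null_Cderive_disk (fun w => CPS (lam_coeff beta 0) w + - beta * w)); [|exact Hu].
  intros w Hw; eapply is_Cderive_eq.
  - apply is_Cderive_plus; [exact (lam_derive beta 0 w H0 Hw)|].
    apply is_Cderive_scal, is_Cderive_id.
  - field; replace (1 + 0 * w) with (RtoC 1) by ring; exact C1_nz. }
rewrite (CPS_0 _ (radius_lam beta 0 H0)) in E; simpl in E.
transitivity (CPS (lam_coeff beta 0) u + - beta * u + beta * u); [ring|].
rewrite E; ring.
Qed.

Definition ext_slope (m : nat) (A : C) (B : R) : C := (A - B) / INR m.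

Definition ext_log (m : nat) (A : C) (B : R) (z : C) : C :=
  CPS (lam_coeff (ext_slope m A B) B) (z ^ m).

Lemma INR_ge_1_neq_0 (m : nat) : (1 <= m)%nat -> RtoC (INR m) <> 0.
Proof. destruct m; [lia | intros _; apply INR_S_neq_0]. Qed.

(** Merges the two cases of [K_extremal]. For B <> 0 the principal logarithm of 1 + B z^m is the
    series with beta = B, and the exponent (A - B) / (m B) rescales it to slope (A - B) / m. *)
Lemma K_extremal_exp (j k : nat) (A : C) (B : R) (z : C) :
  (1 <= j + k - 1)%nat -> (Rabs B < 1)%R -> in_disk z ->
  K_extremal j k A B z = z * Cexp (ext_log (j + k - 1) A B z).
Proof.
intros Hm HB Hz; unfold K_extremal, ext_log, ext_slope.
pose proof (in_disk_pow z _ Hm Hz) as Hu; pose proof (INR_ge_1_neq_0 _ Hm) as Hm0.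
destruct (Req_EM_T B 0) as [->|HB0].
- rewrite CPS_lam_B_0 by exact Hu; do 2 f_equal; field; exact Hm0.
- unfold Cpower; rewrite (CLog_lam B _ HB Hu), (CPS_lam_scal ((A - B) / _) B _ HB HB0 Hu).
  do 2 f_equal; field; split; [exact Hm0|].
  intros E; apply HB0, RtoC_inj, E.
Qed.

Lemma ext_log_derive (m : nat) (A : C) (B : R) (z : C) :
  (1 <= m)%nat -> (Rabs B < 1)%R -> in_disk z ->
  is_Cderive (ext_log m A B) z ((A - B) * z ^ pred m / (1 + B * z ^ m)).
Proof.
intros Hm HB Hz.
pose proof (in_disk_pow z _ Hm Hz) as Hu.
eapply is_Cderive_eq.
- apply (is_Cderive_comp (CPS (lam_coeff (ext_slope m A B) B)) (fun w => w ^ m));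
    [apply lam_derive; assumption | apply is_Cderive_pow].
- unfold ext_slope; field; split; [apply one_plus_neq_0, in_disk_scal; assumption|].
  apply INR_ge_1_neq_0, Hm.
Qed.

Lemma ext_log_0 (m : nat) (A : C) (B : R) :
  (1 <= m)%nat -> (Rabs B < 1)%R -> ext_log m A B 0 = 0.
Proof.
intros Hm HB; unfold ext_log.
replace (0 ^ m) with (RtoC 0) by (destruct m; [lia | simpl; ring]).
rewrite (CPS_0 _ (radius_lam _ B HB)); reflexivity.
Qed.

(** Division by m recovers the index in powers of z^m, so only the values at multiples of m are
    meaningful; the half comes from the factor 2 in the definition of logarithmic coefficients. *)
Definition ext_coeff (m : nat) (A : C) (B : R) (n : nat) : C :=
  lam_coeff (ext_slope m A B) B (n / m) / 2.

Lemma K_extremal_log_coefficients (j k : nat) (A : C) (B : R) :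
  (1 <= j + k - 1)%nat -> (Rabs B < 1)%R ->
  log_coefficients j k (K_extremal j k A B) (ext_coeff (j + k - 1) A B).
Proof.
intros Hm HB; exists (ext_log (j + k - 1) A B); split; [|split; [|split]].
- intros z Hz; eexists; apply ext_log_derive; assumption.
- apply ext_log_0; assumption.
- intros z Hz; unfold over_z; destruct (Ceq_dec z 0) as [->|Hz0].
  + rewrite ext_log_0 by assumption; apply Cexp_0.
  + rewrite K_extremal_exp by assumption; field; exact Hz0.
- intros z Hz; set (m := (j + k - 1)%nat) in *.
  pose proof (is_Cseries_CPS _ _ (radius_lam (ext_slope m A B) B HB) (in_disk_pow z m Hm Hz)) as H.
  apply is_Cseries_incr_1, (is_Cseries_scal (/ 2)) in H.
  apply (is_Cseries_eq _ (/ 2 * (CPS (lam_coeff (ext_slope m A B) B) (z ^ m) -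
    lam_coeff (ext_slope m A B) B 0 * (z ^ m) ^ 0))); [|unfold ext_log; simpl; unfold Cdiv; ring].
  revert H; apply is_Cseries_ext; intros n.
  unfold ext_coeff; rewrite Nat.div_mul by lia.
  rewrite (Nat.mul_comm (S n) m), Cpow_mult_r; unfold Cdiv; ring.
Qed.

(** The weight n cancels the denominator of the logarithmic series: n d_(nm) = (A - B)(-B)^(n-1) /
    (2 m), and a geometric series in B^2 remains. *)
Lemma ext_coeff_energy (m : nat) (A : C) (B : R) :
  (1 <= m)%nat -> (Rabs B < 1)%R ->
  is_series (fun n => INR (S n) ^ 2 * Cmod (ext_coeff m A B (S n * m)) ^ 2)%R
    (1 / (4 * INR m ^ 2) * (Cmod (A - B) ^ 2 / (1 - B ^ 2)))%R.
Proof.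
intros Hm HB.
assert (Hm0 : (0 < INR m)%R) by (apply lt_0_INR; lia).
pose proof (Rabs_def2 _ _ HB) as HB'.
assert (HB2 : (0 <= B ^ 2 < 1)%R) by (simpl; nra).
pose proof (is_series_geom (B ^ 2) ltac:(rewrite Rabs_pos_eq; lra)) as H.
apply (is_series_scal (K := R_AbsRing) (V := R_NormedModule)
  (1 / (4 * INR m ^ 2) * Cmod (A - B) ^ 2)%R) in H.
replace (1 / (4 * INR m ^ 2) * (Cmod (A - B) ^ 2 / (1 - B ^ 2)))%R
  with (1 / (4 * INR m ^ 2) * Cmod (A - B) ^ 2 * / (1 - B ^ 2))%R by (unfold Rdiv; ring).
revert H; apply is_Rseries_ext; intros n.
change scal with Rmult; cbv beta.
unfold ext_coeff; rewrite Nat.div_mul, lam_coeff_S by lia; unfold ext_slope.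
assert (H2 : RtoC 2 <> 0) by (intros E; apply RtoC_inj in E; lra).
rewrite Cmod_div by exact H2; rewrite Cmod_div by apply INR_S_neq_0.
rewrite Cmod_mult, Cmod_div by (apply INR_ge_1_neq_0, Hm).
rewrite Cmod_pow, !Cmod_R, Rabs_Ropp, !(Rabs_pos_eq (INR _)) by apply pos_INR.
rewrite (Rabs_pos_eq 2) by lra.
assert (HS : INR (S n) <> 0%R) by (apply not_0_INR; lia).
rewrite <- (pow2_abs B), <- pow_mult, (Nat.mul_comm 2 n), pow_mult.
set (q := (Rabs B ^ n)%R); field; split; lra.
Qed.

(** * Membership of the extremal function in the class for j = 1 *)

Lemma root_of_unity_pow_self (k : nat) : (1 <= k)%nat -> root_of_unity k ^ k = 1.
Proof.
intros Hk; rewrite root_of_unity_pow.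
assert (INR k <> 0)%R by (apply not_0_INR; lia).
replace (INR k * (2 * PI / INR k))%R with (2 * PI)%R by (field; assumption).
rewrite cos_2PI, sin_2PI; reflexivity.
Qed.

Lemma Cmod_root_of_unity (k : nat) : Cmod (root_of_unity k) = 1%R.
Proof.
unfold root_of_unity; rewrite Cmod_Cexp.
replace (Re _) with 0%R by (simpl; ring); apply exp_0.
Qed.

Lemma K_extremal_derive (k : nat) (A : C) (B : R) (z : C) :
  (1 <= k)%nat -> (Rabs B < 1)%R -> in_disk z ->
  is_Cderive (K_extremal 1 k A B) z
    ((1 + A * z ^ k) / (1 + B * z ^ k) * Cexp (ext_log k A B z)).
Proof.
intros Hk HB Hz.
apply (is_Cderive_ext_disk (fun w => w * Cexp (ext_log k A B w))); [|exact Hz|].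
{ intros w Hw; rewrite K_extremal_exp by (try assumption; lia).
  do 3 f_equal; lia. }
eapply is_Cderive_eq.
- apply is_Cderive_mult; [apply is_Cderive_id|].
  apply is_Cderive_comp; [apply is_Cderive_Cexp | apply ext_log_derive; assumption].
- cbv beta; destruct k as [|k]; [lia|]; simpl pred.
  pose proof (one_plus_neq_0 _ (in_disk_scal B _ HB (in_disk_pow z (S k) Hk Hz))) as Hne.
  rewrite Cpow_S in *; field; exact Hne.
Qed.

Lemma K_extremal_ST (k : nat) (A : C) (B : R) :
  (1 <= k)%nat -> (Rabs B < 1)%R -> ST 1 k A B (K_extremal 1 k A B).
Proof.
intros Hk HB.
assert (Ek : (1 + k - 1 = k)%nat) by lia.
assert (HK : forall z, in_disk z ->
  K_extremal 1 k A B z = z * Cexp (ext_log k A B z)).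
{ intros z Hz; rewrite K_extremal_exp by (try assumption; lia); rewrite Ek; reflexivity. }
assert (Hne : forall z, in_disk z -> 1 + B * z ^ k <> 0).
{ intros z Hz; apply one_plus_neq_0, in_disk_scal, in_disk_pow; assumption. }
assert (H0k : 0 ^ k = 0) by (destruct k; [lia | simpl; ring]).
assert (Hq : analytic_in_disk (fun z => (1 + A * z ^ k) / (1 + B * z ^ k))).
{ intros z Hz; eexists; apply is_Cderive_div; [| |apply Hne, Hz];
    (apply is_Cderive_plus; [apply is_Cderive_const | apply is_Cderive_scal, is_Cderive_pow]). }
assert (Hp : forall z, in_disk z ->
  (1 + A * z ^ k) / (1 + B * z ^ k) = log_derivative (K_extremal 1 k A B) z).
{ intros z Hz; unfold log_derivative; destruct (Ceq_dec z 0) as [->|Hz0].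
  - rewrite H0k; field; replace (1 + B * 0) with (RtoC 1) by ring; exact C1_nz.
  - rewrite (is_C_derive_unique _ _ _ (K_extremal_derive k A B z Hk HB Hz)), HK by exact Hz.
    field; split; [apply Hne, Hz | split; [apply Cexp_neq_0 | exact Hz0]]. }
split; [|split; [|split]].
- split; [|split].
  + intros z Hz; eexists; apply K_extremal_derive; assumption.
  + rewrite HK by exact in_disk_0; ring.
  + eapply is_Cderive_eq; [apply K_extremal_derive; [exact Hk | exact HB | exact in_disk_0]|].
    rewrite H0k, ext_log_0, Cexp_0 by assumption.
    field; replace (1 + B * 0) with (RtoC 1) by ring; exact C1_nz.
- intros z Hz.
  assert (Hz' : in_disk (root_of_unity k * z)).
  { unfold in_disk; rewrite Cmod_mult, Cmod_root_of_unity, Rmult_1_l; exact Hz. }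
  rewrite !HK by assumption; unfold ext_log.
  rewrite Cpow_mult_l, root_of_unity_pow_self, Cmult_1_l, Cpow_1_r by exact Hk; ring.
(* K(z) is z times a power series in z^k: [pred] removes the extra factor z and the division by k
   recovers the index. *)
- exists (fun n => binom_coeff (ext_slope k A B) B (pred n / k)); intros z Hz.
  pose proof (in_disk_pow z k Hk Hz) as Hu.
  pose proof (is_Cseries_CPS _ _ (radius_binom (ext_slope k A B) B HB) Hu) as H.
  apply is_Cseries_incr_1, (is_Cseries_scal z) in H.
  rewrite HK by exact Hz; unfold ext_log; rewrite <- binom_exp_lam by assumption.
  apply (is_Cseries_eq _ (z * (CPS (binom_coeff (ext_slope k A B) B) (z ^ k) -
    binom_coeff (ext_slope k A B) B 0 * (z ^ k) ^ 0))); [|simpl; ring].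
  revert H; apply is_Cseries_ext; intros n.
  replace (pred (S n * k + 1)) with (S n * k)%nat by lia; rewrite Nat.div_mul by lia.
  rewrite Cpow_add_r, Cpow_1_r, (Nat.mul_comm (S n) k), Cpow_mult_r; ring.
- rewrite Ek; split; [|split].
  + intros z Hz; destruct (Hq z Hz) as [l Hl]; exists l.
    exact (is_Cderive_ext_disk _ _ z l Hp Hz Hl).
  + exact Hq.
  (* The logarithmic derivative equals the majorant itself, so the identity serves as the Schwarz
     function. *)
  + exists (fun z => z); split; [|split; [|split]].
    * intros z _; eexists; apply is_Cderive_id.
    * reflexivity.
    * auto.
    * intros z Hz; symmetry; apply Hp, Hz.
Qed.

(** * Quadratic means over roots of unity *)

Lemma sum_n_R_0 (a : nat -> R) : sum_n a 0 = a 0%nat :> R.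
Proof. exact (sum_O a). Qed.

Lemma sum_n_R_S (a : nat -> R) (n : nat) : sum_n a (S n) = (sum_n a n + a (S n))%R :> R.
Proof. exact (sum_Sn a n). Qed.

Lemma sum_n_R_scal (c : R) (a : nat -> R) (n : nat) :
  sum_n (fun k => c * a k)%R n = (c * sum_n a n)%R :> R.
Proof. exact (sum_n_mult_l (K := R_Ring) c a n). Qed.

Lemma Csum_ext (a b : nat -> C) (n : nat) :
  (forall k, a k = b k) -> Csum a n = Csum b n.
Proof.
intros H; induction n as [|n IH]; [rewrite !Csum_0 | rewrite !Csum_S, IH, H]; auto.
Qed.

Lemma Csum_plus (a b : nat -> C) (n : nat) :
  Csum (fun k => a k + b k) n = Csum a n + Csum b n.
Proof.
induction n as [|n IH]; [rewrite !Csum_0 | rewrite !Csum_S, IH; ring]; reflexivity.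
Qed.

Lemma Csum_scal (c : C) (a : nat -> C) (n : nat) :
  Csum (fun k => c * a k) n = c * Csum a n.
Proof.
induction n as [|n IH]; [rewrite !Csum_0 | rewrite !Csum_S, IH; ring]; reflexivity.
Qed.

Lemma Csum_conj (a : nat -> C) (n : nat) :
  Csum (fun k => Cconj (a k)) n = Cconj (Csum a n).
Proof.
induction n as [|n IH]; [rewrite !Csum_0 | rewrite !Csum_S, IH, Cplus_conj]; reflexivity.
Qed.

Lemma Csum_RtoC (a : nat -> R) (n : nat) :
  Csum (fun k => RtoC (a k)) n = RtoC (sum_n a n).
Proof.
induction n as [|n IH]; [rewrite Csum_0, sum_O; reflexivity|].
rewrite Csum_S, sum_Sn, IH, <- RtoC_plus; reflexivity.
Qed.

Lemma Csum_geom (w : C) (n : nat) : (w - 1) * Csum (fun k => w ^ k) n = w ^ S n - 1.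
Proof.
induction n as [|n IH]; [rewrite Csum_0; simpl; ring|].
rewrite Csum_S, Cmult_plus_distr_l, IH, !Cpow_S; ring.
Qed.

Lemma root_of_unity_pow_neq_1 (N n : nat) :
  (0 < n < N)%nat -> root_of_unity N ^ n <> 1.
Proof.
intros Hn E; rewrite root_of_unity_pow in E; injection E as Ec _.
assert (HN : (0 < INR N)%R) by (apply lt_0_INR; lia).
assert (Hn0 : (0 < INR n)%R) by (apply lt_0_INR; lia).
assert (HnN : (INR n < INR N)%R) by (apply lt_INR; lia).
pose proof PI_RGT_0 as HPI.
(* Half the angle lies strictly between 0 and pi, where the sine is positive, so cos (2 t) = 1 - 2
   sin^2 t differs from 1. *)
set (t := (INR n * (PI / INR N))%R).
replace (INR n * (2 * PI / INR N))%R with (2 * t)%R in Ec by (unfold t; field; lra).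
rewrite cos_2a_sin in Ec.
assert (Ht : (0 < t < PI)%R).
{ assert (E : (t * INR N = INR n * PI)%R) by (unfold t; field; lra).
  split; [|nra]; unfold t; apply Rmult_lt_0_compat; [lra|]; apply Rdiv_lt_0_compat; lra. }
assert (0 < sin t)%R by (apply sin_gt_0; lra).
nra.
Qed.

Lemma root_of_unity_sum (N n : nat) : (0 < n <= N)%nat ->
  Csum (fun l => (root_of_unity (S N) ^ l) ^ n) N = 0.
Proof.
intros Hn.
rewrite (Csum_ext _ (fun l => (root_of_unity (S N) ^ n) ^ l)).
2: { intros l; rewrite <- !Cpow_mult_r, Nat.mul_comm; reflexivity. }
set (w := root_of_unity (S N) ^ n).
assert (Hw : w - 1 <> 0).
{ intros E; apply (root_of_unity_pow_neq_1 (S N) n); [lia|]; fold w.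
  replace w with (w - 1 + 1) by ring; rewrite E; ring. }
assert (E : (w - 1) * Csum (fun k => w ^ k) N = 0).
{ rewrite Csum_geom; unfold w.
  rewrite <- Cpow_mult_r, Nat.mul_comm, Cpow_mult_r, root_of_unity_pow_self, Cpow_1_l by lia.
  ring. }
destruct (Ceq_dec (Csum (fun k => w ^ k) N) 0) as [E0|E0]; [exact E0|].
exfalso; exact (Cmult_neq_0 _ _ Hw E0 E).
Qed.

(** [Csum _ N] has N + 1 terms, hence the roots of unity of order [S N]. *)
Definition circle_point (rho : R) (N l : nat) : C := rho * root_of_unity (S N) ^ l.

Lemma Cmod_circle_point (rho : R) (N l : nat) :
  (0 <= rho)%R -> Cmod (circle_point rho N l) = rho.
Proof.
intros H; unfold circle_point.
rewrite Cmod_mult, Cmod_pow, Cmod_root_of_unity, pow1, Cmod_R, Rabs_pos_eq by exact H; ring.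
Qed.

Lemma Cmult_conj_self (z : C) : z * Cconj z = RtoC (Cmod z ^ 2).
Proof. symmetry; apply Cmod2_conj. Qed.

(** On the circle z^p conj(z^q) is rho^(2p) conj(z^(q-p)), and 0 < q - p <= N, so the sum over the
    roots of unity vanishes. *)
Lemma circle_monomials_orthogonal (rho : R) (N p q : nat) :
  (0 <= rho)%R -> (p < q <= N)%nat ->
  Csum (fun l => circle_point rho N l ^ p * Cconj (circle_point rho N l ^ q)) N = 0.
Proof.
intros Hr Hpq.
rewrite (Csum_ext _ (fun l => RtoC ((rho ^ p) ^ 2) * RtoC (rho ^ (q - p)) *
   Cconj ((root_of_unity (S N) ^ l) ^ (q - p)))).
- rewrite Csum_scal, Csum_conj, root_of_unity_sum by lia.
  unfold Cconj; simpl; rewrite Ropp_0; apply Cmult_0_r.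
- intros l; replace q with (p + (q - p))%nat at 1 by lia.
  rewrite Cpow_add_r, Cmult_conj, Cmult_assoc, Cmult_conj_self, Cmod_pow,
    Cmod_circle_point, <- Cmult_assoc by exact Hr.
  f_equal; unfold circle_point.
  rewrite Cpow_mult_l, Cmult_conj, <- RtoC_pow; f_equal.
  unfold Cconj, RtoC; simpl; f_equal; ring.
Qed.

Lemma circle_poly_orthogonal (g : nat -> C) (rho : R) (N p q : nat) :
  (0 <= rho)%R -> (p < q <= N)%nat ->
  Csum (fun l => Csum (fun n => g n * circle_point rho N l ^ n) p *
    Cconj (circle_point rho N l ^ q)) N = 0.
Proof.
intros Hr; induction p as [|p IH]; intros Hpq.
- rewrite (Csum_ext _ (fun l => g 0%nat * (circle_point rho N l ^ 0 *
    Cconj (circle_point rho N l ^ q)))) by (intros l; rewrite Csum_0; ring).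
  rewrite Csum_scal, circle_monomials_orthogonal by assumption; ring.
- rewrite (Csum_ext _ (fun l => Csum (fun n => g n * circle_point rho N l ^ n) p *
    Cconj (circle_point rho N l ^ q) + g (S p) * (circle_point rho N l ^ S p *
    Cconj (circle_point rho N l ^ q)))) by (intros l; rewrite Csum_S; ring).
  rewrite Csum_plus, Csum_scal, IH, circle_monomials_orthogonal by (assumption || lia); ring.
Qed.

(** With N + 1 nodes, distinct exponents up to N are never congruent modulo N + 1, so there is no
    aliasing. In the induction on the degree, the new monomial is orthogonal to the polynomial built
    so far. *)
Lemma discrete_parseval (g : nat -> C) (rho : R) (N p : nat) :
  (0 <= rho)%R -> (p <= N)%nat ->
  sum_n (fun l => Cmod (Csum (fun n => g n * circle_point rho N l ^ n)%C p) ^ 2)%R N =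
  (INR (S N) * sum_n (fun n => Cmod (g n) ^ 2 * (rho ^ n) ^ 2) p)%R.
Proof.
intros Hr Hp; apply RtoC_inj; rewrite <- Csum_RtoC.
set (P := fun p l => Csum (fun n => g n * circle_point rho N l ^ n) p).
change (Csum (fun l => RtoC (Cmod (P p l) ^ 2)) N =
  RtoC (INR (S N) * sum_n (fun n => Cmod (g n) ^ 2 * (rho ^ n) ^ 2)%R p)).
assert (Hc : forall x : C, Csum (fun _ => x) N = INR (S N) * x).
{ intros x; clear; induction N as [|N IH].
  - rewrite Csum_0; simpl; ring.
  - rewrite Csum_S, IH, (S_INR (S N)), RtoC_plus; ring. }
assert (Hq : forall q l, RtoC (Cmod (g q * circle_point rho N l ^ q) ^ 2) =
  RtoC (Cmod (g q) ^ 2 * (rho ^ q) ^ 2)).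
{ intros q l; f_equal; rewrite Cmod_mult, Cmod_pow, Cmod_circle_point by exact Hr; ring. }
induction p as [|p IH].
- rewrite sum_O, (Csum_ext _ (fun _ => RtoC (Cmod (g 0%nat) ^ 2 * (rho ^ 0) ^ 2))).
  + rewrite Hc, (RtoC_mult (INR (S N))); reflexivity.
  + intros l; unfold P; rewrite Csum_0; apply Hq.
- rewrite (Csum_ext _ (fun l => RtoC (Cmod (P p l) ^ 2) +
     RtoC (Cmod (g (S p)) ^ 2 * (rho ^ S p) ^ 2) +
     (Cconj (g (S p)) * (P p l * Cconj (circle_point rho N l ^ S p)) +
      g (S p) * Cconj (P p l * Cconj (circle_point rho N l ^ S p))))).
  + rewrite !Csum_plus, !Csum_scal, Csum_conj, IH, Hc by lia.
    unfold P; rewrite circle_poly_orthogonal by (assumption || lia).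
    replace (Cconj 0) with (RtoC 0) by (unfold Cconj, RtoC; simpl; f_equal; ring).
    rewrite sum_Sn; change plus with Rplus.
    rewrite Rmult_plus_distr_l, RtoC_plus, (RtoC_mult (INR (S N)) (_ * _)); ring.
  + intros l; rewrite <- (Hq (S p) l), <- !Cmult_conj_self; unfold P; rewrite Csum_S.
    fold (P p l); rewrite Cplus_conj, !Cmult_conj, Cconj_conj; ring.
Qed.

Lemma Cmod_tail_le (a : nat -> C) (b : nat -> R) (l : C) (s : R) (M : nat) :
  (forall n, (Cmod (a n) <= b n)%R) -> is_Cseries a l -> is_series b s ->
  (Cmod (l - Csum a M) <= s - sum_n b M)%R.
Proof.
intros Hab Ha Hb.
apply (Cmod_series_le (fun n => a (S M + n)%nat) (fun n => b (S M + n)%nat)).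
- intros n; apply Hab.
- apply (is_series_incr_n (K := C_AbsRing) (V := C_NormedModule) a); [lia|].
  apply (is_Cseries_eq _ _ _ Ha).
  change (l = l - Csum a M + Csum a M); ring.
- apply (is_series_incr_n (K := R_AbsRing) (V := R_NormedModule) b); [lia|].
  assert (E : s = (s - sum_n b M + sum_n b M)%R) by ring.
  rewrite E in Hb; exact Hb.
Qed.

Lemma sum_n_le_index (b : nat -> R) (n p : nat) :
  (forall k, (0 <= b k)%R) -> (n <= p)%nat -> (sum_n b n <= sum_n b p)%R.
Proof.
intros H Hnp; induction Hnp as [|p Hnp IH]; [lra|].
rewrite sum_n_R_S; specialize (H (S p)); lra.
Qed.

Lemma sum_n_le_pointwise (a b : nat -> R) (n : nat) :
  (forall k, (k <= n)%nat -> (a k <= b k)%R) -> (sum_n a n <= sum_n b n)%R.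
Proof.
induction n as [|n IH]; intros H; [rewrite !sum_n_R_0; auto|].
rewrite !sum_n_R_S; apply Rplus_le_compat; auto.
Qed.

(** The pointwise inequality for G passes to its partial sum p, with an error eps in the squares.
    Parseval's identity applied to p and to D - B p then gives E <= |D|^2 + B^2 E + eps for the
    energy E of p. *)
Lemma energy_bound_circle (g : nat -> C) (D : C) (B rho : R) (K : nat) :
  (Rabs B < 1)%R -> radius_ge_1 g -> g 0%nat = 0 -> (0 <= rho < 1)%R ->
  (forall N l, (Cmod (CPS g (circle_point rho N l)) <=
                Cmod (D - B * CPS g (circle_point rho N l)))%R) ->
  ((1 - B ^ 2) * sum_n (fun n => Cmod (g n) ^ 2 * (rho ^ n) ^ 2) K <= Cmod D ^ 2)%R.
Proof.
intros HB Hg Hg0 Hr HG.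
set (en := fun n => (Cmod (g n) ^ 2 * (rho ^ n) ^ 2)%R).
assert (Hen : forall n, (0 <= en n)%R).
{ intros n; apply Rmult_le_pos; apply pow2_ge_0. }
pose proof (Rabs_pos B) as HB0; pose proof (Rabs_def2 _ _ HB) as HB'.
assert (HB2 : (0 < 1 - B ^ 2)%R) by (simpl; nra).
destruct (Hg rho Hr) as [s Hs].
set (bn := fun n => (Cmod (g n) * rho ^ n)%R) in Hs.
assert (Hbn : forall n, (0 <= bn n)%R).
{ intros n; apply Rmult_le_pos; [apply Cmod_ge_0 | apply pow_le; lra]. }
assert (Hs0 : (0 <= s)%R).
{ eapply Rle_trans; [|exact (sum_n_le_series bn s 0 Hbn Hs)]; rewrite sum_n_R_0; apply Hbn. }
set (T := (Cmod D + s)%R).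
assert (HT : (0 <= T)%R) by (unfold T; pose proof (Cmod_ge_0 D); lra).
apply Rle_plus_epsilon; intros eps He.
(* The tail bound dl gives |p| <= |q| + 2 dl with |q| <= T, so the squares differ by at most 4 dl T
   + 4 dl^2 <= dl (4 T + 4), using dl <= 1. *)
set (dl := Rmin 1 (eps / (4 * T + 4))).
assert (Hdl : (0 < dl)%R) by (apply Rmin_pos; [lra | apply Rdiv_lt_0_compat; lra]).
assert (Hdl1 : (dl <= 1)%R) by apply Rmin_l.
assert (Hdl2 : (dl * (4 * T + 4) <= eps)%R).
{ apply Rle_div_r; [lra | apply Rmin_r]. }
clearbody dl.
destruct (proj1 (filterlim_locally_ball_norm _ _) Hs (mkposreal dl Hdl)) as [M0 HM0].
(* M0 makes the tail small; M >= K makes the truncated energy dominate the sum up to K. The same M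
   fixes the number of nodes. *)
set (M := Nat.max K M0).
assert (HM : (s - sum_n bn M <= dl)%R).
{ specialize (HM0 M (Nat.le_max_r _ _)).
  change (Rabs (sum_n bn M - s) < dl)%R in HM0; apply Rabs_def2 in HM0; lra. }
clear HM0.
(* Coefficients of D - B p: the constant term is D alone because g vanishes at 0. *)
set (h := fun n => match n with O => D | S _ => - B * g n end).
set (p := fun l => Csum (fun n => g n * circle_point rho M l ^ n) M).
set (q := fun l => Csum (fun n => h n * circle_point rho M l ^ n) M).
assert (Eq : forall l, q l = D - B * p l).
(* Only the truncation degree is generalised for the induction; the nodes stay those of M. *)
{ intros l; unfold p, q; generalize M at 2 4; intros M'; induction M' as [|M' IH].
  - rewrite !Csum_0, Hg0; simpl; ring.
  - rewrite !Csum_S, IH; simpl h; ring. }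
assert (Hterm : forall l n, Cmod (g n * circle_point rho M l ^ n) = bn n).
{ intros l n; rewrite Cmod_mult, Cmod_pow, Cmod_circle_point by lra; reflexivity. }
assert (Hpq : forall l, (Cmod (p l) ^ 2 <= Cmod (q l) ^ 2 + eps)%R).
{ intros l.
  assert (Hu : in_disk (circle_point rho M l)).
  { unfold in_disk; rewrite Cmod_circle_point; lra. }
  set (G := CPS g (circle_point rho M l)).
  assert (Htail : (Cmod (G - p l) <= dl)%R).
  { eapply Rle_trans; [|exact HM].
    apply (Cmod_tail_le _ bn _ s M); [|apply is_Cseries_CPS; assumption | exact Hs].
    intros n; rewrite Hterm; lra. }
  assert (Hp : (Cmod (p l) <= s)%R).
  { eapply Rle_trans; [apply Cmod_Csum_le | exact (sum_n_le_series bn s M Hbn Hs)].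
    intros n _; rewrite Hterm; lra. }
  assert (Hq : (Cmod (q l) <= T)%R).
  { rewrite Eq; eapply Rle_trans; [apply Cmod_triangle|].
    rewrite Cmod_opp, Cmod_mult, Cmod_R; unfold T.
    pose proof (Cmod_ge_0 (p l)); nra. }
  assert (H1 : (Cmod (p l) <= Cmod G + dl)%R).
  { replace (p l) with (G + - (G - p l)) by ring.
    eapply Rle_trans; [apply Cmod_triangle|]; rewrite Cmod_opp; lra. }
  assert (H2 : (Cmod (D - B * G) <= Cmod (q l) + dl)%R).
  { rewrite Eq; replace (D - B * G) with (D - B * p l + - (B * (G - p l))) by ring.
    eapply Rle_trans; [apply Cmod_triangle|]; rewrite Cmod_opp, Cmod_mult, Cmod_R.
    pose proof (Cmod_ge_0 (G - p l)); nra. }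
  pose proof (HG M l) as H3; fold G in H3.
  pose proof (Cmod_ge_0 (p l)); pose proof (Cmod_ge_0 (q l)).
  assert (H4 : (Cmod (p l) ^ 2 <= (Cmod (q l) + 2 * dl) ^ 2)%R) by (apply pow_incr; lra).
  nra. }
assert (Hsum : (sum_n (fun l => Cmod (p l) ^ 2) M <=
  sum_n (fun l => Cmod (q l) ^ 2 + eps) M)%R).
{ apply sum_n_le_pointwise; intros l _; apply Hpq. }
assert (Hse : forall (v : nat -> R) (n : nat),
  (sum_n (fun l => v l + eps) n = sum_n v n + INR (S n) * eps :> R)%R).
{ clear; intros v n; induction n as [|n IH].
  - rewrite !sum_n_R_0; simpl; ring.
  - rewrite !sum_n_R_S, IH, (S_INR (S n)); ring. }
rewrite Hse in Hsum; unfold p, q in Hsum.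
rewrite !discrete_parseval in Hsum by (lra || lia).
fold en in Hsum.
assert (Eh : (sum_n (fun n => Cmod (h n) ^ 2 * (rho ^ n) ^ 2) M =
   Cmod D ^ 2 + B ^ 2 * sum_n en M :> R)%R).
{ clearbody M; clear - Hg0; induction M as [|M IH].
  - rewrite !sum_n_R_0; unfold en; rewrite Hg0, Cmod_0; simpl; ring.
  - rewrite !sum_n_R_S, IH; unfold en; simpl h.
    rewrite Cmod_mult, Cmod_opp, Cmod_R, Rpow_mult_distr, pow2_abs.
    ring. }
rewrite Eh in Hsum.
assert (HSM : (0 < INR (S M))%R) by (apply lt_0_INR; lia).
assert (Hfin : (sum_n en M <= Cmod D ^ 2 + B ^ 2 * sum_n en M + eps)%R) by nra.
pose proof (sum_n_le_index en K M Hen (Nat.le_max_l _ _)) as HKM.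
nra.
Qed.

(** * Letting the radius tend to 1 *)

Lemma Bernoulli_sub (x : R) (n : nat) : (0 <= x <= 1)%R -> (1 - INR n * x <= (1 - x) ^ n)%R.
Proof.
intros Hx; induction n as [|n IH]; [simpl; lra|].
rewrite <- tech_pow_Rmult, S_INR.
pose proof (pos_INR n).
assert ((1 - x) * (1 - INR n * x) <= (1 - x) * (1 - x) ^ n)%R by
  (apply Rmult_le_compat_l; lra).
nra.
Qed.

(** A limit rho -> 1 replaced by one explicit radius: if X > Q >= 0, then rho = 1 - x with x = (X -
    Q) / (2 (n + 1) X) gives rho^n X >= (1 - n x) X > Q by Bernoulli's inequality. *)
Lemma le_of_pow_scaled (n : nat) (X Q : R) : (0 <= Q)%R ->
  (forall rho, (0 <= rho < 1)%R -> (rho ^ n * X <= Q)%R) -> (X <= Q)%R.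
Proof.
intros HQ H; apply Rnot_lt_le; intros HX.
pose proof (pos_INR n) as Hn.
set (x := ((X - Q) / (2 * (INR n + 1) * X))%R).
assert (E : (x * (2 * (INR n + 1) * X) = X - Q)%R) by (unfold x; field; lra).
assert (Hx0 : (0 < x)%R) by (apply Rdiv_lt_0_compat; [lra|]; apply Rmult_lt_0_compat; lra).
assert (Hx1 : (x <= 1)%R).
{ apply Rle_div_l; [apply Rmult_lt_0_compat; lra|]; nra. }
specialize (H (1 - x)%R ltac:(lra)).
pose proof (Bernoulli_sub x n ltac:(lra)) as HBn.
assert ((1 - INR n * x) * X <= (1 - x) ^ n * X)%R by (apply Rmult_le_compat_r; lra).
assert (0 < x * X)%R by (apply Rmult_lt_0_compat; lra).
nra.
Qed.

Lemma energy_bound (g : nat -> C) (D : C) (B : R) (K : nat) :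
  (Rabs B < 1)%R -> radius_ge_1 g -> g 0%nat = 0 ->
  (forall rho N l, (0 <= rho < 1)%R -> (Cmod (CPS g (circle_point rho N l)) <=
                Cmod (D - B * CPS g (circle_point rho N l)))%R) ->
  ((1 - B ^ 2) * sum_n (fun n => Cmod (g n) ^ 2) K <= Cmod D ^ 2)%R.
Proof.
intros HB Hg Hg0 HG.
pose proof (Rabs_def2 _ _ HB) as HB'.
assert (HB2 : (0 < 1 - B ^ 2)%R) by (simpl; nra).
(* For n <= K each weight (rho^n)^2 is at least rho^(2K), so this single factor can be pulled out of
   the finite sum. *)
apply (le_of_pow_scaled (K * 2)); [apply pow2_ge_0|]; intros rho Hr.
eapply Rle_trans; [|apply (energy_bound_circle g D B rho K HB Hg Hg0 Hr); intros; apply HG, Hr].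
rewrite <- Rmult_assoc, (Rmult_comm (rho ^ _)), Rmult_assoc.
apply Rmult_le_compat_l; [lra|].
rewrite <- sum_n_R_scal; apply sum_n_le_pointwise; intros n Hn; rewrite Rmult_comm.
apply Rmult_le_compat_l; [apply pow2_ge_0|].
rewrite pow_mult; apply pow_incr; split; [apply pow_le; lra|].
replace K with (n + (K - n))%nat by lia; rewrite pow_add.
assert (rho ^ (K - n) <= 1)%R by (rewrite <- (pow1 (K - n)); apply pow_incr; lra).
pose proof (pow_le rho n (proj1 Hr)); nra.
Qed.

(** * The coefficient inequality *)

Lemma radius_ge_1_of_bounded_terms (c : nat -> C) :
  (forall x, (0 <= x < 1)%R -> exists M : R, forall n, (Cmod (c n) * x ^ n <= M)%R) ->
  radius_ge_1 c.
Proof.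
intros H; apply CV_radius_ge_1; intros x Hx; rewrite Rabs_pos_eq by lra.
apply Rbar_lt_le_trans with ((x + 1) / 2)%R; [simpl; lra|].
apply (proj1 (CV_radius_bounded (fun n => Cmod (c n)))).
destruct (H ((x + 1) / 2)%R ltac:(lra)) as [M HM]; exists M; intros n.
rewrite Rabs_pos_eq; [apply HM|].
apply Rmult_le_pos; [apply Cmod_ge_0 | apply pow_le; lra].
Qed.

Lemma is_Cseries_terms_bounded (a : nat -> C) (l : C) :
  is_Cseries a l -> exists M : R, forall n, (Cmod (a n) <= M)%R.
Proof.
intros H; destruct (proj1 (is_Cseries_eps a l) H 1%R Rlt_0_1) as [N HN].
apply (eventually_bounded _ (S N) 2); intros [|n] Hn; [lia|].
pose proof (HN n ltac:(lia)) as H1; pose proof (HN (S n) ltac:(lia)) as H2.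
replace (a (S n)) with (Csum a (S n) - l + - (Csum a n - l)) by (rewrite Csum_S; ring).
eapply Rle_trans; [apply Cmod_triangle|]; rewrite Cmod_opp; lra.
Qed.

Lemma Rpow_root (x : R) (m : nat) : (1 <= m)%nat -> (0 <= x < 1)%R ->
  exists s, (0 <= s < 1)%R /\ (s ^ m = x)%R.
Proof.
intros Hm Hx; destruct (Req_dec x 0) as [->|Hx0].
- exists 0%R; split; [lra | apply pow_i; lia].
- assert (Hm0 : (0 < INR m)%R) by (apply lt_0_INR; lia).
  exists (Rpower x (/ INR m)); split.
  + unfold Rpower; split; [apply Rlt_le, exp_pos|].
    rewrite <- exp_0; apply exp_increasing.
    assert (ln x < 0)%R by (rewrite <- ln_1; apply ln_increasing; lra).
    pose proof (Rinv_0_lt_compat _ Hm0); nra.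
  + rewrite <- Rpower_pow by apply exp_pos.
    rewrite Rpower_mult, Rinv_l, Rpower_1; lra.
Qed.

Lemma Cexp_pow (z : C) (n : nat) : Cexp z ^ n = Cexp (INR n * z).
Proof.
induction n as [|n IH].
- simpl; rewrite Cmult_0_l, Cexp_0; reflexivity.
- rewrite Cpow_S, IH, <- Cexp_plus, S_INR, RtoC_plus; f_equal; ring.
Qed.

(** Every sampling point in the variable u is some z^m: take the m-th root of the radius and divide
    the angle by m. *)
Lemma circle_point_root (m : nat) (rho : R) (N l : nat) :
  (1 <= m)%nat -> (0 <= rho < 1)%R ->
  exists z, in_disk z /\ z ^ m = circle_point rho N l.
Proof.
intros Hm Hr; destruct (Rpow_root rho m Hm Hr) as [s [Hs Es]].
set (w := RtoC (2 * PI / INR (S N)) * Ci).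
exists (s * Cexp (RtoC (INR l / INR m) * w)); split.
- unfold in_disk; rewrite Cmod_mult, Cmod_Cexp, Cmod_R, Rabs_pos_eq by lra.
  replace (Re _) with 0%R by (unfold w; simpl; ring); rewrite exp_0; lra.
- unfold circle_point, root_of_unity; fold w.
  rewrite Cpow_mult_l, <- RtoC_pow, Es, !Cexp_pow; do 2 f_equal.
  rewrite RtoC_div by (apply not_0_INR; lia); field; apply INR_ge_1_neq_0, Hm.
Qed.

(** The constant term is set to 0 because the value of [d] at 0 is left free by
    [log_coefficients]. *)
Definition log_series_coeff (m : nat) (d : nat -> C) (n : nat) : C :=
  match n with O => 0 | S _ => d (n * m)%nat end.

Lemma log_series (m : nat) (d : nat -> C) (L : C -> C) (z : C) :
  is_Cseries (fun n => d (S n * m)%nat * z ^ (S n * m)) (L z / 2) ->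
  is_Cseries (fun n => log_series_coeff m d n * (z ^ m) ^ n) (L z / 2).
Proof.
intros H; apply (is_Cseries_eq _ (L z / 2 + log_series_coeff m d 0 * (z ^ m) ^ 0));
  [|simpl; ring].
apply is_Cseries_decr_1; revert H; apply is_Cseries_ext; intros n.
rewrite <- Cpow_mult_r, (Nat.mul_comm m); reflexivity.
Qed.

(** Convergence at the real point s with s^m = x bounds the terms at x; since x < 1 is arbitrary,
    Abel's lemma gives absolute convergence. *)
Lemma log_series_radius (m : nat) (d : nat -> C) (L : C -> C) :
  (1 <= m)%nat ->
  (forall z, in_disk z ->
     is_Cseries (fun n => d (S n * m)%nat * z ^ (S n * m)) (L z / 2)) ->
  radius_ge_1 (log_series_coeff m d).
Proof.
intros Hm H; apply radius_ge_1_of_bounded_terms; intros x Hx.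
destruct (Rpow_root x m Hm Hx) as [s [Hs Es]].
assert (Hd : in_disk s) by (unfold in_disk; rewrite Cmod_R, Rabs_pos_eq; lra).
destruct (is_Cseries_terms_bounded _ _ (log_series _ _ _ _ (H _ Hd))) as [M HM].
exists M; intros n; specialize (HM n).
rewrite Cmod_mult, !Cmod_pow, Cmod_R, Rabs_pos_eq, Es in HM by lra; exact HM.
Qed.

(* Coefficients of [z L'(z)] as a power series in [z ^ m]. *)
Definition zlog_coeff (m : nat) (d : nat -> C) (n : nat) : C :=
  2 * INR m * (INR n * log_series_coeff m d n).

Lemma zlog_coeff_S (m : nat) (d : nat -> C) (n : nat) :
  zlog_coeff m d (S n) = 2 * INR m * CPS_derive (log_series_coeff m d) n.
Proof. reflexivity. Qed.

Lemma zlog_radius (m : nat) (d : nat -> C) :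
  radius_ge_1 (log_series_coeff m d) -> radius_ge_1 (zlog_coeff m d).
Proof.
intros H; apply radius_ge_1_derive in H; intros x Hx; apply ex_series_incr_1.
destruct (H x Hx) as [s Hs].
exists (Cmod (2 * INR m) * x * s)%R.
apply (is_series_scal (K := R_AbsRing) (V := R_NormedModule) (Cmod (2 * INR m) * x)%R) in Hs.
revert Hs; apply is_Rseries_ext; intros n; change scal with Rmult; cbv beta.
rewrite zlog_coeff_S, (Cmod_mult (2 * INR m)), <- tech_pow_Rmult; ring.
Qed.

Lemma zlog_CPS (m : nat) (d : nat -> C) (u : C) :
  radius_ge_1 (log_series_coeff m d) -> in_disk u ->
  CPS (zlog_coeff m d) u =
  2 * INR m * (u * CPS (CPS_derive (log_series_coeff m d)) u).
Proof.
intros H Hu; apply (is_Cseries_unique _ _ _ (is_Cseries_CPS _ u (zlog_radius m d H) Hu)).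
eapply is_Cseries_eq; [apply is_Cseries_decr_1|].
- eapply is_Cseries_ext; [|exact (is_Cseries_scal (2 * INR m * u) _ _
    (is_Cseries_CPS _ u (radius_ge_1_derive _ H) Hu))].
  intros n; cbv beta; rewrite zlog_coeff_S, Cpow_S; ring.
- unfold zlog_coeff; simpl; ring.
Qed.

(** Logarithmic differentiation of f(w) = w exp (L w). The hypothesis f(0) = 0 makes this
    factorisation hold at w = 0 as well, where [over_z] takes its conventional value. *)
Lemma log_derivative_exp (f L : C -> C) (z l : C) :
  f 0 = 0 -> (forall w, in_disk w -> Cexp (L w) = over_z f w) ->
  in_disk z -> z <> 0 -> is_Cderive L z l -> log_derivative f z = 1 + z * l.
Proof.
intros Hf0 HL Hz Hz0 Hl.
assert (Hf : forall w, in_disk w -> w * Cexp (L w) = f w).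
{ intros w Hw; rewrite HL by exact Hw; unfold over_z; destruct (Ceq_dec w 0) as [->|Hw0].
  - rewrite Hf0; ring.
  - field; exact Hw0. }
assert (Hd : is_Cderive f z (1 * Cexp (L z) + z * (l * Cexp (L z)))).
{ apply (is_Cderive_ext_disk _ _ _ _ Hf Hz).
  apply (is_Cderive_mult (fun w => w) (fun w => Cexp (L w))); [apply is_Cderive_id|].
  apply is_Cderive_comp; [apply is_Cderive_Cexp | exact Hl]. }
unfold log_derivative; destruct (Ceq_dec z 0) as [E|_]; [contradiction|].
rewrite (is_C_derive_unique _ _ _ Hd), <- Hf by exact Hz.
field; split; [apply Cexp_neq_0 | exact Hz0].
Qed.

(* [G = (A - B) phi / (1 + B phi)] solves to [G = phi (A - B - B G)]. *)
Lemma Cmod_subordinate_le (A phi G : C) (B : R) :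
  (Rabs B < 1)%R -> in_disk phi ->
  1 + G = (1 + A * phi) / (1 + B * phi) -> (Cmod G <= Cmod (A - B - B * G))%R.
Proof.
intros HB Hphi E.
pose proof (one_plus_neq_0 _ (in_disk_scal B phi HB Hphi)) as Hne.
assert (EG : G = phi * (A - B - B * G)).
{ replace G with ((1 + A * phi) / (1 + B * phi) - 1) by (rewrite <- E; ring).
  field; exact Hne. }
rewrite EG at 1; rewrite Cmod_mult.
unfold in_disk in Hphi; pose proof (Cmod_ge_0 (A - B - B * G)); nra.
Qed.

Lemma ST_log_bound (j k : nat) (A : C) (B : R) (f : C -> C) (d : nat -> C) (K : nat) :
  (1 <= j + k - 1)%nat -> (Rabs B < 1)%R ->
  ST j k A B f -> log_coefficients j k f d ->
  (sum_n (fun n => INR (S n) ^ 2 * Cmod (d (S n * (j + k - 1))%nat) ^ 2) K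
   <= 1 / (4 * INR (j + k - 1) ^ 2) * (Cmod (A - B) ^ 2 / (1 - B ^ 2)))%R.
Proof.
set (m := (j + k - 1)%nat).
intros Hm HB [[_ [Hf0 _]] [_ [_ [_ [_ [w [_ [_ [Hw Hfw]]]]]]]]] [L [_ [_ [HL Hser]]]].
fold m in Hfw, Hser.
pose proof (log_series_radius m d L Hm Hser) as Hrad.
set (c := log_series_coeff m d) in *.
assert (HLc : forall z, in_disk z -> 2 * CPS c (z ^ m) = L z).
{ intros z Hz.
  rewrite (is_Cseries_unique _ _ _ (is_Cseries_CPS c _ Hrad (in_disk_pow z m Hm Hz))
    (log_series m d L z (Hser z Hz))).
  field; intros E; apply RtoC_inj in E; lra. }
assert (HG : forall z, in_disk z ->
  (Cmod (CPS (zlog_coeff m d) (z ^ m)) <= Cmod (A - B - B * CPS (zlog_coeff m d) (z ^ m)))%R).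
{ intros z Hz; pose proof (in_disk_pow z m Hm Hz) as Hu.
  rewrite zlog_CPS by assumption; fold c.
  destruct (Ceq_dec z 0) as [Hz0|Hz0].
  (* At z = 0 the value of G is 0 and the bound is trivial; elsewhere log (f/z) can be
     differentiated. *)
  - replace (z ^ m) with (RtoC 0) by (rewrite Hz0; destruct m; [lia | simpl; ring]).
    replace (2 * INR m * (0 * CPS (CPS_derive c) 0)) with (RtoC 0) by ring.
    rewrite Cmod_0; apply Cmod_ge_0.
  (* Here phi = w(z)^m with w the Schwarz function of the subordination, and G(z^m) = z L'(z). *)
  - apply (Cmod_subordinate_le A (w z ^ m)); [exact HB | apply in_disk_pow; [exact Hm | apply Hw, Hz]|].
    rewrite <- Hfw by exact Hz; symmetry.
    rewrite (log_derivative_exp f L z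
      (2 * (INR m * z ^ pred m * CPS (CPS_derive c) (z ^ m))) Hf0 HL Hz Hz0).
    + set (X := CPS (CPS_derive c) (z ^ m)).
      replace (z ^ m) with (z * z ^ pred m) by (destruct m; [lia | reflexivity]); ring.
    + apply (is_Cderive_ext_disk _ _ _ _ HLc Hz), is_Cderive_scal.
      apply (is_Cderive_comp (CPS c) (fun w => w ^ m)); [|apply is_Cderive_pow].
      apply is_Cderive_CPS; assumption. }
(* The cut-off is [S K] because coefficient 0 of z L' vanishes and the sum over [d] starts at its
   coefficient 1. *)
assert (HE := energy_bound (zlog_coeff m d) (A - B) B (S K) HB (zlog_radius m d Hrad)
  ltac:(unfold zlog_coeff; simpl; ring)
  ltac:(intros rho N l Hr; destruct (circle_point_root m rho N l Hm Hr) as [z [Hz <-]];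
        apply HG, Hz)).
pose proof (Rabs_def2 _ _ HB) as HB'.
assert (HB2 : (0 < 1 - B ^ 2)%R) by (simpl; nra).
assert (Hm0 : (0 < INR m)%R) by (apply lt_0_INR; lia).
(* The factor 4 m^2 of the final constant is the squared modulus of 2 m in the coefficient 2 n m
   d_(nm). *)
assert (Hsum : forall n, (4 * INR m ^ 2 *
   sum_n (fun n => INR (S n) ^ 2 * Cmod (d (S n * m)%nat) ^ 2) n =
   sum_n (fun n => Cmod (zlog_coeff m d n) ^ 2) (S n) :> R)%R).
{ assert (Hz : forall n, (Cmod (zlog_coeff m d (S n)) ^ 2 =
    4 * INR m ^ 2 * (INR (S n) ^ 2 * Cmod (d (S n * m)%nat) ^ 2))%R).
  { intros n; unfold zlog_coeff; rewrite !Cmod_mult, !Cmod_R, !(Rabs_pos_eq (INR _)) by apply pos_INR.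
    rewrite (Rabs_pos_eq 2) by lra; unfold log_series_coeff; ring. }
  induction n as [|n IH].
  - rewrite sum_n_R_S, !sum_n_R_0, Hz.
    replace (zlog_coeff m d 0) with (RtoC 0) by (unfold zlog_coeff; simpl; ring).
    rewrite Cmod_0; ring.
  - rewrite sum_n_R_S, (sum_n_R_S _ (S n)), <- IH, Hz; ring. }
rewrite <- Hsum in HE.
replace (1 / (4 * INR m ^ 2) * (Cmod (A - B) ^ 2 / (1 - B ^ 2)))%R
  with (Cmod (A - B) ^ 2 / ((1 - B ^ 2) * (4 * INR m ^ 2)))%R by (field; split; lra).
apply Rle_div_r; [apply Rmult_lt_0_compat; [lra|]; pose proof (pow_lt _ 2 Hm0); lra|].
lra.
Qed.

Lemma nonneg_series_bounded (b : nat -> R) (Q : R) :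
  (forall n, (0 <= b n)%R) -> (forall n, (sum_n b n <= Q)%R) ->
  ex_series b /\ (Series b <= Q)%R.
Proof.
intros Hb HQ.
assert (Hex : ex_series b).
{ destruct (ex_finite_lim_seq_incr (sum_n b) Q) as [l Hl].
  - intros n; rewrite sum_n_R_S; specialize (Hb (S n)); lra.
  - exact HQ.
  - exists l; exact Hl. }
split; [exact Hex|].
exact (is_lim_seq_le (sum_n b) (fun _ => Q) (Finite (Series b)) (Finite Q) HQ
  (Series_correct _ Hex) (is_lim_seq_const Q)).
Qed.

Theorem theorem2p3 (j k : nat) (A : C) (B : R)
  (hk : (1 <= k)%nat)
  (hj : (j < k)%nat \/ (j = 1%nat /\ k = 1%nat))
  (hjk : (1 <= j + k - 1)%nat)
  (hB : (-1 <= B <= 0)%R)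
  (hAB : A <> RtoC B)
  (hB1 : B <> (-1)%R) :
  (forall (f : C -> C) (d : nat -> C),
     ST j k A B f -> log_coefficients j k f d ->
     ex_series (fun n : nat =>
       (INR (S n) ^ 2 * Cmod (d (S n * (j + k - 1))%nat) ^ 2)%R) /\
     (Series (fun n : nat =>
        INR (S n) ^ 2 * Cmod (d (S n * (j + k - 1))%nat) ^ 2)
      <= 1 / (4 * INR (j + k - 1) ^ 2) * (Cmod (A - B) ^ 2 / (1 - B ^ 2)))%R) /\
  (* sharpness: ST j k A B is empty unless j = 1, see ST_j_eq_1 *)
  (exists d : nat -> C,
     log_coefficients j k (K_extremal j k A B) d /\
     is_series (fun n : nat =>
       (INR (S n) ^ 2 * Cmod (d (S n * (j + k - 1))%nat) ^ 2)%R)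
       (1 / (4 * INR (j + k - 1) ^ 2) * (Cmod (A - B) ^ 2 / (1 - B ^ 2)))%R) /\
  (j = 1%nat -> ST j k A B (K_extremal j k A B)).
Proof.
(* With B <> -1 the range of B becomes |B| < 1, which keeps 1 + B u away from 0 and makes 1 - B^2
   positive. *)
assert (HB : (Rabs B < 1)%R) by (apply Rabs_def1; lra).
split; [|split].
- intros f d Hf Hd; apply nonneg_series_bounded.
  + intros n; apply Rmult_le_pos; apply pow2_ge_0.
  + intros n; exact (ST_log_bound j k A B f d n hjk HB Hf Hd).
- exists (ext_coeff (j + k - 1) A B); split.
  + apply K_extremal_log_coefficients; assumption.
  + apply ext_coeff_energy; assumption.
- intros ->; apply K_extremal_ST; assumption.
Qed.
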